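(* Let $p(\cdot)\in\mathcal{P}_0$ with $p(\cdot)\in LH$. Then the following statements hold: (i) For any $d\in(-\infty,0)$, $\mathbb{D}^{\rm lower}_{p(\cdot),\infty,d}=\emptyset$ and $\mathbb{D}^{\rm upper}_{p(\cdot),\infty,d}=\emptyset$. (ii) For any $W\in\mathscr{A}_{p(\cdot),\infty}$, there exists $d_1\in[0,\frac{n}{p_-})$ such that $W\in\mathbb{D}^{\rm lower}_{p(\cdot),\infty,d_1}$. (iii) For any $W\in\mathscr{A}_{p(\cdot),\infty}$, there exists $d_2\in[0,\infty)$ such that $W\in\mathbb{D}^{\rm upper}_{p(\cdot),\infty,d_2}$.
   Context: $m,n\in\mathbb{N}$; $M_m$ is the set of $m\times m$ complex matrices, with operator norm $\|\cdot\|$. $\mathcal{P}_0$ is the set of measurable $p:\mathbb{R}^n\to(0,\infty]$ with $p_-:=\operatorname{ess\,inf}_{x\in\mathbb{R}^n}p(x)>0$. A measurable real-valued function $r$ on $\mathbb{R}^n$ belongs to $LH$ if there is $C_0>0$ with $|r(x)-r(y)|\le -\frac{C_0}{\log|x-y|}$ whenever $|x-y|<\frac12$, and there are positive constants $r_\infty,C_\infty$ with $|r(x)-r_\infty|\le\frac{C_\infty}{\log(e+|x|)}$ for all $x$. For a measurable function $f$, $\|f\|_{L^{p(\cdot)}}:=\inf\{\lambda>0:\int_{\mathbb{R}^n}|f(x)/\lambda|^{p(x)}\,dx\le1\}$ (with $\inf\emptyset=\infty$). Cubes have finite positive edge length and edges parallel to the axes (not necessarily open or closed); $\lambda Q$ is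 the cube with the same center as $Q$ and edge length $\lambda$ times that of $Q$; $\fint_Q$ denotes the average $\frac1{|Q|}\int_Q$. A matrix weight is a function $W:\mathbb{R}^n\to M_m$ such that $W(x)$ is nonnegative definite and invertible for almost every $x$ and all entries of $W$ are locally integrable. $\mathscr{A}_{p(\cdot),\infty}$ is the class of matrix weights $W$ with $$[W]_{\mathscr{A}_{p(\cdot),\infty}}:=\sup_Q\exp\left(\fint_Q\log\left(\frac{1}{\|\mathbf{1}_Q\|_{L^{p(\cdot)}}}\left\|\,\|W(\cdot)W^{-1}(y)\|\,\mathbf{1}_Q(\cdot)\right\|_{L^{p(\cdot)}}\right)dy\right)<\infty,$$ the supremum being over all cubes. For $d\in\mathbb{R}$, a matrix weight $W$ is in $\mathbb{D}^{\rm lower}_{p(\cdot),\infty,d}$ (has $\mathscr{A}_{p(\cdot),\infty}$-lower dimension $d$) if there is $C>0$ such that, for all $\lambda\in[1,\infty)$ and all cubes $Q$, $$\exp\left(\fint_{\lambda Q}\log\left(\frac{1}{\|\mathbf{1}_Q\|_{L^{p(\cdot)}}}\left\|\,\|W(\cdot)W^{-1}(y)\|\,\mathbf{1}_Q\right\|_{L^{p(\cdot)}}\right)dy\right)\le C\lambda^d;$$ it is in $\mathbb{D}^{\rm upper}_{p(\cdot),\infty,d}$ (has $\mathscr{A}_{p(\cdot),\infty}$-upper dimension $d$) if there is $C>0$ such that, for all $\lambda\in[1,\infty)$ and all cubes $Q$, $$\exp\left(\fint_{Q}\log\left(\frac{1}{\|\mathbf{1}_{\lambda Q}\|_{L^{p(\cdot)}}}\left\|\,\|W(\cdot)W^{-1}(y)\|\,\mathbf{1}_{\lambda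 Q}\right\|_{L^{p(\cdot)}}\right)dy\right)\le C\lambda^d.$$ *)

(* Defs.v *)
From HB Require Import structures.
From mathcomp Require Import all_boot all_order all_algebra.
From mathcomp Require Import complex.
From mathcomp Require Import all_classical all_reals all_analysis.
From mathcomp Require Import measurable_realfun ess_sup_inf.

Set Implicit Arguments.
Unset Strict Implicit.
Unset Printing Implicit Defensive.
Import Order.TTheory GRing.Theory Num.Def Num.Theory.
Import numFieldNormedType.Exports.
Import ComplexField.Normc.

Local Open Scope classical_set_scope.
Local Open Scope ring_scope.
Local Open Scope complex_scope.
Local Open Scope sesquilinear_scope.

Notation borelRn R n := (n.-tuple (measurableTypeR R)).

Lemma sigma_finite_product d1 d2 (T1 : measurableType d1)
    (T2 : measurableType d2) (R : realType)
    (m1 : {sigma_finite_measure set T1 -> \bar R})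
    (m2 : {sigma_finite_measure set T2 -> \bar R}) :
  sigma_finite setT (m1 \x m2)%E.
Proof.
have /sigma_finiteP[F [TF ndF Foo]] := sigma_finiteT m1.
have /sigma_finiteP[G [TG ndG Goo]] := sigma_finiteT m2.
exists (fun k => F k `*` G k).
  rewrite -setXTT TF TG predeqE => -[x y]; split.
    move=> [/= [i _ Fix] [j _ Gjy]]; exists (maxn i j) => //; split.
    - by move: x Fix; exact/subsetPset/ndF/leq_maxl.
    - by move: y Gjy; exact/subsetPset/ndG/leq_maxr.
  by move=> [i _ [/= ? ?]]; split; exists i.
move=> k; have [? ?] := Foo k; have [? ?] := Goo k.
split; first exact: measurableX.
by rewrite product_measure1E// lte_mul_pinfty// ge0_fin_numE.
Qed.

Section cons_measure.
Local Open Scope ereal_scope.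
Context {R : realType} {n : nat}.

Definition consRn (x : measurableTypeR R * borelRn R n) : borelRn R n.+1 :=
  [tuple of x.1 :: x.2].

Definition unconsRn (x : borelRn R n.+1) : measurableTypeR R * borelRn R n :=
  (thead x, [tuple of behead x]).

Lemma consRnK : cancel consRn unconsRn.
Proof. by case=> a x; congr pair; apply/val_inj. Qed.

Lemma measurable_consRn : measurable_fun setT consRn.
Proof. exact: measurable_cons. Qed.

Lemma measurable_unconsRn : measurable_fun setT unconsRn.
Proof.
apply/measurable_fun_pairP; split; first exact: measurable_tnth.
exact: measurable_behead.
Qed.

Variable mu : {sigma_finite_measure set (borelRn R n) -> \bar R}.

Definition cons_measure : set (borelRn R n.+1) -> \bar R :=
  pushforward (lebesgue_measure \x mu) consRn.

Let cons_measure0 : cons_measure set0 = 0.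
Proof. by rewrite /cons_measure /pushforward preimage_set0 measure0. Qed.

Let cons_measure_ge0 A : 0 <= cons_measure A.
Proof. by rewrite /cons_measure /pushforward measure_ge0. Qed.

Let cons_measure_sigma_additive : semi_sigma_additive cons_measure.
Proof.
have mc := measurable_consRn.
move=> F mF tF mUF; rewrite /cons_measure /pushforward preimage_bigcup.
apply: measure_semi_sigma_additive.
- by move=> k; rewrite -[X in measurable X]setTI; exact: mc.
- apply/trivIsetP => /= i j _ _ ij; rewrite -preimage_setI.
  by move/trivIsetP : tF => /(_ _ _ _ _ ij) ->//; rewrite preimage_set0.
- by rewrite -preimage_bigcup -[X in measurable X]setTI; exact: mc.
Qed.

HB.instance Definition _ := isMeasure.Build _ _ _ cons_measure
  cons_measure0 cons_measure_ge0 cons_measure_sigma_additive.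

Let cons_measure_sigma_finite : sigma_finite setT cons_measure.
Proof.
pose lam : {sigma_finite_measure set (measurableTypeR R) -> \bar R} :=
  lebesgue_measure.
have [F FT Foo] := sigma_finite_product lam mu.
exists (fun k => unconsRn @^-1` F k).
  by rewrite -preimage_bigcup -FT preimage_setT.
move=> k; have [mFk Fkoo] := Foo k; split.
  by rewrite -[X in measurable X]setTI; exact: measurable_unconsRn.
rewrite /cons_measure /pushforward -comp_preimage (_ : _ \o _ = idfun)//.
by apply/funext => x /=; rewrite consRnK.
Qed.

HB.instance Definition _ := Measure_isSigmaFinite.Build _ _ _ cons_measure
  cons_measure_sigma_finite.

End cons_measure.

Fixpoint borel_measureRn (R : realType) (n : nat) :
    {sigma_finite_measure set (borelRn R n) -> \bar R} :=
  match n with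
  | 0 => \d_ [tuple]
  | n'.+1 => cons_measure (borel_measureRn R n')
  end.

(* R^n with the sigma-algebra of Lebesgue-measurable sets: the completion of the
   product Borel space. *)
Definition Rn (R : realType) (n : nat) : Type :=
  caratheodory_type (borel_measureRn R n)^*%mu.
HB.instance Definition _ (R : realType) (n : nat) :=
  Measurable.copy (Rn R n) (caratheodory_type (borel_measureRn R n)^*%mu).

Definition lebesgueRn {R : realType} {n : nat} : set (Rn R n) -> \bar R :=
  @completed_measure_extension _ _ _ (borel_measureRn R n).
HB.instance Definition _ (R : realType) (n : nat) :=
  Measure.copy (@lebesgueRn R n)
    (@completed_measure_extension _ _ _ (borel_measureRn R n)).

Lemma lebesgueRn_sigma_finite (R : realType) (n : nat) :
  sigma_finite setT (@lebesgueRn R n).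
Proof.
apply: completed_measure_extension_sigma_finite.
exact: (sigma_finiteT (borel_measureRn R n)).
Qed.

HB.instance Definition _ (R : realType) (n : nat) :=
  Measure_isSigmaFinite.Build _ _ _ (@lebesgueRn R n)
  (lebesgueRn_sigma_finite R n).

Section variable_exponent.
Context {R : realType} {n : nat}.
Implicit Types (x y : Rn R n) (p : Rn R n -> \bar R) (f : Rn R n -> R).

Definition coordRn x (i : 'I_n) : R := tnth x i.

Definition enorm x : R := sqrtr (\sum_(i < n) coordRn x i ^+ 2).

Definition edist x y : R :=
  sqrtr (\sum_(i < n) (coordRn x i - coordRn y i) ^+ 2).

Definition p_minus p : \bar R := ess_inf lebesgueRn p.

Definition P0 p : Prop :=
  [/\ measurable_fun setT p, forall x, (0 < p x)%E & (0 < p_minus p)%E].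

(* At x = y the right-hand side of the first inequality is 0, since
   [ln 0 = 0] and [0^-1 = 0]; this agrees with the usual convention. *)
Definition LH f : Prop :=
  [/\ measurable_fun setT f,
      exists2 C0 : R, 0 < C0 & forall x y, edist x y < 2^-1 ->
        `|f x - f y| <= - (C0 / ln (edist x y)) &
      exists rinfty Cinfty : R, [/\ 0 < rinfty, 0 < Cinfty &
        forall x, `|f x - rinfty| <= Cinfty / ln (expR 1 + enorm x)]].

(* t ^ q for t >= 0 and 0 < q <= +oo, with the convention that t ^ +oo is 0
   when t <= 1 and +oo otherwise; the value at q = -oo is irrelevant. *)
Definition epow (t : R) (q : \bar R) : \bar R :=
  match q with
  | r%:E => (t `^ r)%:E
  | +oo => if (t <= 1)%R then 0 else +oo
  | -oo => 0
  end%E.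

Definition modular p f : \bar R := (\int[lebesgueRn]_x epow `|f x| (p x))%E.

Definition vnorm p f : \bar R :=
  ereal_inf [set l%:E | l in
    [set l : R | 0 < l /\ (modular p (fun x => f x / l)%R <= 1)%E]].

(* The flags tell, for each axis, whether the lower (resp. upper) face belongs
   to the cube. Genuine cubes are those with a positive edge. *)
Record cube := Cube {
  cube_center : Rn R n;
  cube_edge : R;
  cube_lower : 'I_n -> bool;
  cube_upper : 'I_n -> bool }.

Definition cube_set (Q : cube) : set (Rn R n) :=
  [set x | forall i : 'I_n, coordRn x i \in
    Interval
      (BSide (cube_lower Q i) (coordRn (cube_center Q) i - cube_edge Q / 2))
      (BSide (~~ cube_upper Q i) (coordRn (cube_center Q) i + cube_edge Q / 2))].

Definition dilate (l : R) (Q : cube) : cube :=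
  Cube (cube_center Q) (l * cube_edge Q) (cube_lower Q) (cube_upper Q).

Definition average (A : set (Rn R n)) (g : Rn R n -> \bar R) : \bar R :=
  ((lebesgueRn A)^-1 * \int[lebesgueRn]_(y in A) g y)%E.

End variable_exponent.
Arguments cube : clear implicits.

Section complex_matrices.
Context {R : realType} {m : nat}.
Implicit Types (M : 'M[R[i]]_m) (z : 'cV[R[i]]_m).

Definition cvnorm z : R := sqrtr (\sum_(i < m) normc (z i 0) ^+ 2).

Definition opnorm M : R :=
  sup [set cvnorm (M *m z) | z in [set z | cvnorm z = 1]].

Definition nonneg_definite M : Prop := forall z, 0 <= (z ^t* *m M *m z) 0 0.

End complex_matrices.

Section weights.
Context {R : realType} {m n : nat}.
Implicit Types (W : Rn R n -> 'M[R[i]]_m) (p : Rn R n -> \bar R).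

Definition bounded_Rn (A : set (Rn R n)) : Prop :=
  exists r : R, forall x, A x -> enorm x <= r.

Definition locally_integrable_Rn (f : Rn R n -> R[i]) : Prop :=
  forall A : set (Rn R n), measurable A -> bounded_Rn A ->
    lebesgueRn.-integrable A (fun x => (complex.Re (f x))%:E) /\
    lebesgueRn.-integrable A (fun x => (complex.Im (f x))%:E).

Definition matrix_weight W : Prop :=
  {ae lebesgueRn, forall x, nonneg_definite (W x) /\ W x \in unitmx} /\
  forall i j, locally_integrable_Rn (fun x => W x i j).

Definition normalized_norm p W (A : set (Rn R n)) (y : Rn R n) : \bar R :=
  ((vnorm p \1_A)^-1 *
   vnorm p (fun x => opnorm (W x *m invmx (W y)) * \1_A x)%R)%E.

(* [A] is the domain of the logarithmic mean, [B] that of the norm. *)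
Definition exp_mean_log p W (A B : set (Rn R n)) : \bar R :=
  expeR (average A (fun y => lne (normalized_norm p W B y))).

Definition A_infty_constant p W : \bar R :=
  ereal_sup [set exp_mean_log p W (cube_set Q) (cube_set Q) | Q in
    [set Q : cube R n | 0 < cube_edge Q]].

Definition A_infty p : set (Rn R n -> 'M[R[i]]_m) :=
  [set W | matrix_weight W /\ (A_infty_constant p W < +oo)%E].

Definition D_lower p (d : R) : set (Rn R n -> 'M[R[i]]_m) :=
  [set W | matrix_weight W /\
    exists2 C : R, 0 < C & forall (l : R) (Q : cube R n),
      1 <= l -> 0 < cube_edge Q ->
      (exp_mean_log p W (cube_set (dilate l Q)) (cube_set Q)
        <= (C * l `^ d)%:E)%E].

Definition D_upper p (d : R) : set (Rn R n -> 'M[R[i]]_m) :=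
  [set W | matrix_weight W /\
    exists2 C : R, 0 < C & forall (l : R) (Q : cube R n),
      1 <= l -> 0 < cube_edge Q ->
      (exp_mean_log p W (cube_set Q) (cube_set (dilate l Q))
        <= (C * l `^ d)%:E)%E].

End weights.

(* Main.v *)
Require Import Defs.
From mathcomp Require Import all_boot all_order all_algebra.
From mathcomp Require Import complex.
From mathcomp Require Import all_classical all_reals all_analysis.
From mathcomp Require Import measurable_realfun ess_sup_inf.
From mathcomp Require Import ring lra zify.

Set Implicit Arguments.
Unset Strict Implicit.
Unset Printing Implicit Defensive.
Import Order.TTheory GRing.Theory Num.Def Num.Theory.
Import numFieldNormedType.Exports.
Import ComplexField.Normc.

Local Open Scope classical_set_scope.
Local Open Scope ring_scope.

(** Write [u_A x] for the operator norm of [W x *m A], let [F_u(Q)] be the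
    variable-exponent norm of [u] over the cube [Q], and let
    [N_u(Q) = F_u(Q) / F_1(Q)] be the normalised norm.  All three statements
    reduce to one fact about scalar weights: if [W] satisfies the
    [A_{p,oo}]-condition, then for every invertible [A] the function [ln u_A]
    has bounded mean oscillation around the number [ln N_{u_A}(Q)], with a
    bound that depends neither on [A] nor on [Q].

    From matrices to scalars.  Submultiplicativity of the operator norm gives
    [N_{u_A}(Q) / u_A(y) <= N_Q(y)], where [N_Q(y)] is the quantity whose
    logarithm is averaged in the definitions (lemma [log_ratio_sub_le]).  Hence
    the mean over [Q] of [ln N_{u_A}(Q) - ln u_A] is bounded above.

    The other half of the oscillation bound.  The mean over [Q] of the
    positive part of [ln u - ln N_u(Q)] is bounded for every weight (lemma
    [mean_pos_log_le]): by [ln y <= y] applied to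
    [y = |Q| (u / F_u(Q))^{p(x)}], whose mean is at most 1, everything
    reduces to the mean over [Q] of [|ln F_1(Q) - ln |Q| / p(x)|].  That mean
    is bounded by log-Hoelder continuity: small cubes see an almost constant
    exponent, and in a large cube the exponent is close to its limit at
    infinity except near the origin, on a set of measure at most a small
    power of [|Q|].

    Consequences of bounded oscillation.  Two nested cubes of comparable size
    have comparable values of [ln N], so [ln N(lQ)] exceeds [ln N(Q)] by at
    most a multiple of [ln l] (lemma [abs_mean_dilate_le]); applied to every
    [u_A] with [A] the inverse of [W y] and averaged over [y], this is (iii).
    The same comparison shows that the part of [3Q] outside [Q] carries a
    fixed share of [F_u(3Q)]; since the exponent is bounded this forces
    [F_u(Q) <= theta F_u(3Q)] with [theta < 1] (lemma [log_norm_step]).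
    Combined with [F_1(lQ) <= C l^{n/p_-} F_1(Q)] it lowers the trivial
    exponent [n / p_-] strictly, which is (ii).

    For (i), a negative dimension [d] would make [ln N_u(Q)] and
    [ln N_u(lQ)], with [u = u_1], differ by at least [|d| ln l - C] for all
    cubes.  But if a cube [P] is cut into [M^n] equal cubes, one of them, [Q],
    has mean oscillation around [ln N_u(P)] at most twice the bound for [P],
    so [ln N_u(Q)], [ln N_u(P)] and [ln N_u(2M Q)] are within a constant of
    each other (lemma [exists_cube_stable_dilate]); let [M] grow. *)

(** * Cubes and their measure *)

Section boxes.
Context {R : realType}.

Lemma measurable_box n (I : 'I_n -> interval R) :
  measurable ([set x | forall i, tnth x i \in I i] : set (borelRn R n)).
Proof.
rewrite (_ : mkset _ =
    \bigcap_(i in [set: 'I_n]) ((fun x => tnth x i) @^-1` [set` I i])).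
  apply: fin_bigcap_measurable => [|i _]; first exact: finite_finset.
  by rewrite -[X in measurable X]setTI; exact: measurable_tnth.
by apply/seteqP; split => x /= h i; [move=> _; exact: h|exact: h].
Qed.

Lemma borel_measure_box n (I : 'I_n -> interval R) :
  borel_measureRn R n [set x | forall i, tnth x i \in I i] =
  (\prod_(i < n) lebesgue_measure [set` I i])%E.
Proof.
elim: n I => [|n ih] I.
  rewrite big_ord0 /= diracE mem_set//= => -[]//.
rewrite big_ord_recl /= /cons_measure /pushforward.
rewrite (_ : _ @^-1` _ = [set` I ord0] `*`
    [set x | forall i, tnth x i \in I (lift ord0 i)]).
  rewrite product_measure1E//; last exact: measurable_box.
  by congr (_ * _)%E; rewrite ih.
apply/seteqP; split => -[a x] /=.
  move=> h; split => /= [|i]; first by have := h ord0; rewrite tnth0.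
  by have := h (lift ord0 i); rewrite tnthS.
move=> [/= ha hx] i; case: (unliftP ord0 i) => [j ->|->]; last by rewrite tnth0.
by rewrite tnthS; exact: hx.
Qed.

End boxes.

Section cubes.
Context {R : realType} {n : nat}.
Implicit Types (x y : Rn R n) (Q P : cube R n).

Definition point_of (f : 'I_n -> R) : Rn R n := [tuple f i | i < n].

Lemma coord_point_of f i : coordRn (point_of f) i = f i.
Proof. exact: tnth_mktuple. Qed.

Lemma measurable_borel_Rn (A : set (borelRn R n)) :
  measurable A -> measurable (A : set (Rn R n)).
Proof. exact: caratheodory_measurable_mu_ext. Qed.

Lemma measurable_coordRn i : measurable_fun [set: Rn R n] (fun x => coordRn x i).
Proof.
move=> _ A mA; apply: measurable_borel_Rn.
exact: (@measurable_tnth _ _ _ i measurableT).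
Qed.

Lemma measurable_cube Q : measurable (cube_set Q).
Proof. by apply: measurable_borel_Rn; exact: measurable_box. Qed.

Definition vol Q : R := cube_edge Q ^+ n.

Lemma vol_gt0 Q : 0 < cube_edge Q -> 0 < vol Q.
Proof. exact: exprn_gt0. Qed.

Lemma lebesgue_cube Q : 0 < cube_edge Q -> lebesgueRn (cube_set Q) = (vol Q)%:E.
Proof.
move=> Q0; have mQ := measurable_box (fun i => Interval
  (BSide (cube_lower Q i) (coordRn (cube_center Q) i - cube_edge Q / 2))
  (BSide (~~ cube_upper Q i) (coordRn (cube_center Q) i + cube_edge Q / 2))).
rewrite [LHS](etrans (measurable_mu_extE (borel_measureRn R n) mQ)
  (borel_measure_box _)).
rewrite (eq_bigr (fun=> (cube_edge Q)%:E)); last first.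
  move=> i _; rewrite lebesgue_measure_itv /= lte_fin ifT.
    by rewrite -EFinD; congr EFin; lra.
  lra.
by rewrite /vol prodEFin; congr EFin; rewrite prodr_const card_ord.
Qed.

Lemma cube_coord_le Q x i : cube_set Q x ->
  `|coordRn x i - coordRn (cube_center Q) i| <= cube_edge Q / 2.
Proof.
move=> /(_ i); rewrite in_itv /= => /andP[].
by case: (cube_lower Q i) => /=; case: (cube_upper Q i) => /= h1 h2;
  rewrite ler_norml; lra.
Qed.

Lemma cube_coord_lt Q x :
  (forall i, `|coordRn x i - coordRn (cube_center Q) i| < cube_edge Q / 2) ->
  cube_set Q x.
Proof.
move=> h i; move: (h i); rewrite ltr_norml in_itv /= => /andP[].
by case: (cube_lower Q i) => /=; case: (cube_upper Q i) => /= h1 h2;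
  apply/andP; split; lra.
Qed.

(** The strict inequality puts the closure of [P] in the interior of [Q], so
    that the faces do not matter. *)
Lemma cube_subset P Q :
  (forall i, `|coordRn (cube_center P) i - coordRn (cube_center Q) i|
     + cube_edge P / 2 < cube_edge Q / 2) ->
  cube_set P `<=` cube_set Q.
Proof.
move=> h x Px; apply: cube_coord_lt => i.
have := cube_coord_le i Px; have := h i; rewrite ler_norml ltr_norml.
set a := coordRn _ _; set b := coordRn _ _; set c := coordRn x i.
have := ler_norm (a - b); have := ler_norm (- (a - b)); rewrite normrN; lra.
Qed.

Lemma dilate_subset a b Q : a <= b -> 0 < cube_edge Q ->
  cube_set (dilate a Q) `<=` cube_set (dilate b Q).
Proof.
move=> ab Q0 x Qx i; move: (Qx i); rewrite !in_itv /= => /andP[].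
have : a * cube_edge Q <= b * cube_edge Q by rewrite ler_pM2r.
by case: (cube_lower Q i) => /=; case: (cube_upper Q i) => /= ? ? ?;
  apply/andP; split; lra.
Qed.

Lemma dilate1 Q : dilate 1 Q = Q.
Proof. by case: Q => c e l u; rewrite /dilate /= mul1r. Qed.

Lemma dilateM a b Q : dilate a (dilate b Q) = dilate (a * b) Q.
Proof. by rewrite /dilate /= mulrA. Qed.

Lemma sub_dilate l Q : 1 <= l -> 0 < cube_edge Q ->
  cube_set Q `<=` cube_set (dilate l Q).
Proof. by move=> l1 Q0; rewrite -{1}[Q]dilate1; exact: dilate_subset. Qed.

Lemma vol_dilate l Q : vol (dilate l Q) = l ^+ n * vol Q.
Proof. by rewrite /vol /= exprMn. Qed.

Lemma coord_le_enorm x i : `|coordRn x i| <= enorm x.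
Proof.
rewrite -[leLHS]sqrtr_sqr /enorm ler_sqrt.
  by rewrite (bigD1 i)//= lerDl sumr_ge0// => j _; exact: sqr_ge0.
by rewrite sumr_ge0// => j _; exact: sqr_ge0.
Qed.

Lemma sqrt_sum_sqr_le (a : 'I_n -> R) M : (forall i, `|a i| <= M) ->
  sqrtr (\sum_(i < n) a i ^+ 2) <= n%:R * M.
Proof.
move=> aM; have [n0|n0] := posnP n.
  rewrite big1 ?sqrtr0 ?n0 ?mul0r// => i; move: (ltn_ord i); rewrite {2}n0; lia.
have M0 : 0 <= M by apply: le_trans (aM (Ordinal n0)).
rewrite -[leRHS]ger0_norm ?mulr_ge0// -sqrtr_sqr ler_sqrt ?sqr_ge0//.
apply: (@le_trans _ _ (\sum_(i < n) M ^+ 2)).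
  apply: ler_sum => i _; rewrite -[a i ^+ 2]real_normK ?num_real//.
  by rewrite lerXn2r ?nnegrE.
rewrite sumr_const card_ord -[leLHS]mulr_natl exprMn ler_wpM2r ?sqr_ge0//.
by rewrite expr2 ler_peMl// ler1n.
Qed.

(** A crude dimensional constant suffices: only the logarithm of the
    distance matters for the exponent. *)
Lemma edist_center_le Q x : cube_set Q x -> Defs.edist x (cube_center Q) <= n%:R * cube_edge Q.
Proof.
move=> Qx; have [n0|n0] := posnP n.
  by apply: sqrt_sum_sqr_le => i; move: (ltn_ord i); rewrite {2}n0; lia.
have Q0 := cube_coord_le (Ordinal n0) Qx.
apply: sqrt_sum_sqr_le => i; apply: le_trans (cube_coord_le i Qx) _.
by have := le_trans (normr_ge0 _) Q0; lra.
Qed.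

Lemma bounded_cube Q : bounded_Rn (cube_set Q).
Proof.
exists (n%:R * (\sum_(i < n) `|coordRn (cube_center Q) i| + `|cube_edge Q|)) => x Qx.
apply: sqrt_sum_sqr_le => i.
have := cube_coord_le i Qx.
set c := coordRn (cube_center Q) i => h.
have hs : `|c| <= \sum_(i < n) `|coordRn (cube_center Q) i|.
  by rewrite (bigD1 i)//= lerDl sumr_ge0.
have : `|coordRn x i| <= `|coordRn x i - c| + `|c|.
  by rewrite -{1}[coordRn x i](subrK c); exact: ler_normD.
have := ler_norm (cube_edge Q); have := normr_ge0 (cube_edge Q); lra.
Qed.

Lemma measurable_enorm : measurable_fun [set: Rn R n] (@enorm R n).
Proof.
apply: measurableT_comp.
  by apply: continuous_measurable_fun; exact: sqrt_continuous.
apply: measurable_sum => i; apply: measurable_funX; exact: measurable_coordRn.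
Qed.

Definition centered_cube (l : R) : cube R n :=
  Cube (point_of (fun=> 0)) l (fun=> true) (fun=> true).

Lemma enorm_le_cube r x : enorm x <= r -> cube_set (centered_cube (2 * r)) x.
Proof.
move=> xr i; have := le_trans (coord_le_enorm x i) xr.
rewrite ler_norml in_itv /= coord_point_of => /andP[? ?].
by apply/andP; split; lra.
Qed.

Lemma lebesgueRn_ball_le (r : R) : 0 < r ->
  (lebesgueRn [set x : Rn R n | (enorm x <= r)%R] <= ((2 * r) ^+ n)%:E)%E.
Proof.
move=> r0; have r2 : 0 < cube_edge (centered_cube (2 * r)) by rewrite /=; lra.
rewrite -[X in EFin X]/(vol (centered_cube (2 * r))) -lebesgue_cube//.
apply: le_measure; rewrite ?inE; last by move=> x; exact: enorm_le_cube.
  rewrite (_ : mkset _ = setT `&` (@enorm R n) @^-1` `]-oo, r]).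
    exact: measurable_enorm.
  by apply/seteqP; split => x /=; rewrite in_itv/= => // -[].
exact: measurable_cube.
Qed.

End cubes.

Section tiling.
Context {R : realType} {n : nat}.
Local Notation mu := (@lebesgueRn R n).

(** Half-open faces make these [M ^ n] cubes a partition. *)
Definition subcube (c : Rn R n) (l : R) (M : nat) (f : {ffun 'I_n -> 'I_M}) : cube R n :=
  Cube (point_of (fun i => coordRn c i - l / 2 + ((f i)%:R + 2^-1) * (l / M%:R)))
    (l / M%:R) (fun=> true) (fun=> false).

Lemma in_subcube c l M f x : cube_set (@subcube c l M f) x <->
  forall i, coordRn c i - l / 2 + (f i)%:R * (l / M%:R) <= coordRn x i
    < coordRn c i - l / 2 + (f i).+1%:R * (l / M%:R).
Proof.
split => h i; move: (h i); rewrite ?in_itv /= !coord_point_of -[(f i).+1%:R]natr1;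
 set h' := l / M%:R => /andP[? ?]; apply/andP; split; nra.
Qed.

Lemma subcube_sub c l M f : (0 < M)%N -> 0 < l ->
  cube_set (@subcube c l M f) `<=` cube_set (Cube c l (fun=> true) (fun=> false)).
Proof.
move=> M0 l0 x /in_subcube h i; rewrite in_itv /=.
have h0 : 0 < l / M%:R by rewrite divr_gt0// ltr0n.
have hM : M%:R * (l / M%:R) = l by rewrite mulrC divfK// pnatr_eq0; lia.
have fM : (f i).+1%:R * (l / M%:R) <= M%:R * (l / M%:R) by rewrite ler_pM2r// ler_nat.
have f0 : 0 <= (f i)%:R * (l / M%:R) by rewrite mulr_ge0// ltW.
by move: (h i) => /andP[? ?]; apply/andP; split; lra.
Qed.

Lemma trivIset_subcube c l M : (0 < M)%N -> 0 < l ->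
  trivIset setT (fun f => cube_set (@subcube c l M f)).
Proof.
move=> M0 l0 f g _ _ [x [/in_subcube hf /in_subcube hg]].
have h0 : 0 < l / M%:R by rewrite divr_gt0// ltr0n.
apply/ffunP => i; apply/val_inj => /=.
move: (hf i) (hg i) => /andP[f1 f2] /andP[g1 g2].
have : (f i)%:R * (l / M%:R) < (g i).+1%:R * (l / M%:R) by lra.
have : (g i)%:R * (l / M%:R) < (f i).+1%:R * (l / M%:R) by lra.
rewrite !ltr_pM2r// !ltr_nat; lia.
Qed.

(** Pigeonhole on the [M ^ n] subcubes; the factor 2 leaves room to argue with
    non-strict inequalities only. *)
Lemma exists_subcube_le c l M (g : Rn R n -> \bar R) (B : R) :
  (0 < M)%N -> 0 < l -> 0 < B ->
  measurable_fun setT g -> (forall x, 0 <= g x)%E ->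
  let P := Cube c l (fun=> true) (fun=> false) in
  (\int[mu]_(x in cube_set P) g x <= (B * vol P)%:E)%E ->
  exists f, let Q := @subcube c l M f in
    (\int[mu]_(x in cube_set Q) g x <= (2 * B * vol Q)%:E)%E.
Proof.
move=> M0 l0 B0 mg g0 P hP; apply/not_existsP => h.
have MR : 0 < M%:R :> R by rewrite ltr0n.
set s := index_enum {ffun 'I_n -> 'I_M}.
have us : uniq s by exact: index_enum_uniq.
have := @ge0_integral_bigsetU _ _ _ mu _ _ g s
  (fun f => measurable_cube (@subcube c l M f)) us
  (sub_trivIset (@subsetT _ _) (trivIset_subcube M0 l0)) (measurable_funTS mg)
  (fun x _ => g0 x).
set D := \big[setU/set0]_(i <- s) _ => hD.
have : (\int[mu]_(x in D) g x <= \int[mu]_(x in cube_set P) g x)%E.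
  apply: ge0_subset_integral => //.
  - by apply: bigsetU_measurable => f _; exact: measurable_cube.
  - exact: measurable_cube.
  - exact: measurable_funTS.
  - rewrite /D -bigcup_seq => x [f _]; exact: subcube_sub.
rewrite leNgt => /negP; apply.
apply: le_lt_trans hP _; rewrite hD.
apply: (@lt_le_trans _ _ (\sum_(f <- s) (2 * B * vol (subcube c l f))%:E)%E); last first.
  by apply: lee_sum => f _; rewrite leNgt; apply/negP => /ltW; exact: h.
rewrite sumEFin lte_fin (eq_bigr (fun=> 2 * B * (l / M%:R) ^+ n))//.
rewrite /s big_const_seq count_predT iter_addr_0.
have -> : size (index_enum {ffun 'I_n -> 'I_M}) = (M ^ n)%N.
  by rewrite -[index_enum _]enumT -cardT card_ffun !card_ord.
rewrite /P /vol /=.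
rewrite -mulrnAr -[X in 2 * B * X]mulr_natl natrX -exprMn.
rewrite [M%:R * _]mulrC divfK ?gt_eqF//.
have : 0 < B * l ^+ n by rewrite mulr_gt0// exprn_gt0.
by rewrite -mulrA; lra.
Qed.

End tiling.

(** * Oscillation of a log-Hoelder exponent on cubes *)

Ltac nonneg := by repeat first [done | apply: ltW; assumption | exact: ler0n
  | apply: mulr_ge0 | apply: divr_ge0 | apply: addr_ge0 | apply: exprn_ge0
  | rewrite invr_ge0 | rewrite oppr_ge0].

Lemma normr_invB (R : realFieldType) (pm a b : R) : 0 < pm -> pm <= a -> pm <= b ->
  `|a^-1 - b^-1| <= `|a - b| / pm ^+ 2.
Proof.
move=> pm0 pa pb.
have a0 : 0 < a by exact: lt_le_trans pa.
have b0 : 0 < b by exact: lt_le_trans pb.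
have -> : a^-1 - b^-1 = (b - a) / (a * b) by field; rewrite !gt_eqF.
have ab0 : 0 < a * b by exact: mulr_gt0.
rewrite normrM distrC [`|(a * b)^-1|]ger0_norm ?invr_ge0 ?(ltW ab0)//.
apply: ler_wpM2l => //; rewrite lef_pV2 ?posrE ?exprn_gt0 ?mulr_gt0//.
by rewrite expr2; apply: ler_pM => //; exact: ltW.
Qed.

Lemma normr_invB_le (R : realFieldType) (pm a b : R) : 0 < pm -> pm <= a -> pm <= b ->
  `|a^-1 - b^-1| <= pm^-1.
Proof.
move=> pm0 pa pb.
have a0 : 0 < a by exact: lt_le_trans pa.
have b0 : 0 < b by exact: lt_le_trans pb.
have : a^-1 <= pm^-1 by rewrite lef_pV2 ?posrE.
have : b^-1 <= pm^-1 by rewrite lef_pV2 ?posrE.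
have : 0 < a^-1 by rewrite invr_gt0.
have : 0 < b^-1 by rewrite invr_gt0.
by rewrite ler_norml; lra.
Qed.

Section log_holder.
Context {R : realType} {n : nat}.
Variables (q : Rn R n -> R) (pm C0 rinf Cinf : R).
Hypothesis n_gt0 : (0 < n)%N.
Hypothesis pm_gt0 : 0 < pm.
Hypothesis q_ge : forall x, pm <= q x.
Hypothesis C0_gt0 : 0 < C0.
Hypothesis LH0 : forall x y, Defs.edist x y < 2^-1 ->
        `|q x - q y| <= - (C0 / ln (Defs.edist x y)).
Hypothesis rinf_ge : pm <= rinf.
Hypothesis Cinf_gt0 : 0 < Cinf.
Hypothesis LHinf : forall x, `|q x - rinf| <= Cinf / ln (expR 1 + enorm x).

(** The constant exponent that models [q] on [Q], for which the norm of the
    indicator of [Q] is comparable to [vol Q `^ (ref_exponent Q)^-1]. *)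
Definition ref_exponent (Q : cube R n) : R :=
  if cube_edge Q < 1 then q (cube_center Q) else rinf.

(** The absolute value of the logarithm of the factor lost when
    [vol Q `^ (q x)^-1] is replaced by [vol Q `^ (ref_exponent Q)^-1]. *)
Definition log_osc (Q : cube R n) (x : Rn R n) : R :=
  `|ln (vol Q)| * `|(q x)^-1 - (ref_exponent Q)^-1|.

Lemma ln_vol (Q : cube R n) : 0 < cube_edge Q -> ln (vol Q) = n%:R * ln (cube_edge Q).
Proof. by move=> Q0; rewrite /vol lnXn// mulr_natl. Qed.

Lemma enorm_ge0 (x : Rn R n) : 0 <= enorm x.
Proof. exact: sqrtr_ge0. Qed.

Lemma ln_enorm_ge1 (x : Rn R n) : 1 <= ln (expR 1 + enorm x).
Proof.
rewrite -[leLHS]expRK ler_ln ?posrE ?expR_gt0// ?ltr_wpDr ?enorm_ge0 ?expR_gt0//.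
by rewrite lerDl enorm_ge0.
Qed.

(** Below a threshold edge the logarithms of the edge and of the diameter are
    comparable, and the modulus of continuity absorbs [ln (vol Q)]; between
    the threshold and 1, [ln (vol Q)] itself is bounded. *)
Lemma log_osc_small Q x : 0 < cube_edge Q -> cube_edge Q < 1 -> cube_set Q x ->
  log_osc Q x <= 2 * n%:R * C0 / pm ^+ 2 + 2 * n%:R * ln (2 * n%:R) / pm.
Proof.
move=> Q0 Q1 Qx; set e := cube_edge Q in Q0 Q1.
have nR : 1 <= n%:R :> R by rewrite ler1n.
have le0 : ln e < 0 by rewrite ln_lt0// Q0.
have ln2n : 0 <= ln (2 * n%:R) :> R by rewrite ln_ge0//; lra.
have pm2 : 0 < pm ^+ 2 by rewrite exprn_gt0.
have B1 : 0 <= 2 * n%:R * C0 / pm ^+ 2 by nonneg.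
have B2 : 0 <= 2 * n%:R * ln (2 * n%:R) / pm.
  nonneg.
have Ln : `|ln (vol Q)| = n%:R * - ln e.
  by rewrite ln_vol// normrM normr_nat ltr0_norm.
have rE : ref_exponent Q = q (cube_center Q) by rewrite /ref_exponent Q1.
rewrite /log_osc Ln.
(* The threshold is edge [(2 n) ^ -2]: below it [ln (n * e) <= ln e / 2]. *)
have [big|small] := ltP (- ln e) (2 * ln (2 * n%:R)).
  rewrite (@le_trans _ _ (2 * n%:R * ln (2 * n%:R) / pm)) ?lerDr//.
  apply: ler_pM => //; first nonneg.
    have := ler_wpM2l (ler0n R n) (ltW big); lra.
  by apply: normr_invB_le => //; rewrite rE.
rewrite (@le_trans _ _ (2 * n%:R * C0 / pm ^+ 2)) ?lerDl//.
have dle := edist_center_le Qx; rewrite -/e in dle.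
have d0 : 0 <= Defs.edist x (cube_center Q) by exact: sqrtr_ge0.
have ne : 0 < n%:R * e by rewrite mulr_gt0//; lra.
have n0 : 0 < n%:R :> R by lra.
have ln2n_eq : ln (2 * n%:R) = ln 2 + ln n%:R :> R by rewrite lnM ?posrE.
have ln2 : 0 < ln 2 :> R by rewrite ln_gt0//; lra.
have lnne : ln (n%:R * e) = ln n%:R + ln e by rewrite lnM ?posrE.
have lnn : ln (n%:R * e) <= ln e / 2 by lra.
have d2 : Defs.edist x (cube_center Q) < 2^-1.
  apply: le_lt_trans dle _; rewrite -ltr_ln ?posrE// ?invr_gt0// lnV ?posrE//.
  have : 0 <= ln n%:R :> R by rewrite ln_ge0.
  lra.
have qle : `|q x - q (cube_center Q)| <= 2 * C0 / (- ln e).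
  apply: le_trans (LH0 d2) _.
  move: d0; rewrite le_eqVlt => /orP[/eqP <-|d0].
    (* A point at distance 0 from the centre: [ln 0] and [0^-1] are both 0. *)
    rewrite ln0// invr0 mulr0 oppr0 divr_ge0// ?mulr_ge0 ?oppr_ge0//; exact: ltW.
  have lnd : ln (Defs.edist x (cube_center Q)) <= ln e / 2.
    by apply: le_trans lnn; rewrite ler_ln ?posrE.
  rewrite -mulrN -invrN [2 * C0]mulrC -mulrA ler_wpM2l ?(ltW C0_gt0)//.
  have -> : 2 / - ln e = (- ln e / 2)^-1 by field; rewrite lt_eqF.
  by rewrite lef_pV2 ?posrE; lra.
have := normr_invB pm_gt0 (q_ge x) (q_ge (cube_center Q)); rewrite rE => h.
have le1 : 0 < - ln e by rewrite oppr_gt0.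
apply: (@le_trans _ _ (n%:R * - ln e * (2 * C0 / (- ln e) / pm ^+ 2))).
  apply: ler_wpM2l; first by rewrite mulr_ge0// ltW.
  by apply: le_trans h _; rewrite ler_pM2r// invr_gt0.
by rewrite le_eqVlt; apply/orP; left; apply/eqP; field; rewrite (gt_eqF pm_gt0) (lt_eqF le0).
Qed.

(** Outside the ball of radius [edge ^ eps] the decay
    [1 / ln (e + |x|)] is at most [1 / (eps * ln edge)]. *)
Lemma log_osc_large Q x eps : 0 < eps -> 1 <= cube_edge Q ->
  cube_edge Q `^ eps < enorm x ->
  log_osc Q x <= n%:R * Cinf / (eps * pm ^+ 2).
Proof.
move=> e0 Q1 xQ; set e := cube_edge Q in Q1 xQ.
have Q0 : 0 < cube_edge Q by rewrite -/e; lra.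
have le0 : 0 <= ln e by rewrite ln_ge0.
have pm2 : 0 < pm ^+ 2 by rewrite exprn_gt0.
have rE : ref_exponent Q = rinf by rewrite /ref_exponent ltNge Q1.
have h1 := ln_enorm_ge1 x; set t := ln (_ + _) in h1.
have t0 : 0 < t by lra.
have et : eps * ln e <= t.
  have ep : 0 < e `^ eps by rewrite powR_gt0.
  rewrite -ln_powR ler_ln ?posrE//; last first.
    by rewrite ltr_wpDr ?expR_gt0// enorm_ge0.
  by have := expR_gt0 (1 : R); lra.
rewrite /log_osc ln_vol// -/e normrM normr_nat ger0_norm//.
have h := normr_invB pm_gt0 (q_ge x) rinf_ge; rewrite rE.
apply: (@le_trans _ _ (n%:R * (t / eps) * (Cinf / t / pm ^+ 2))).
  apply: ler_pM => //; first by rewrite mulr_ge0.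
    by rewrite ler_wpM2l// ler_pdivlMr// mulrC.
  by apply: le_trans h _; rewrite ler_pM2r ?invr_gt0.
by rewrite le_eqVlt; apply/orP; left; apply/eqP; field; rewrite !gt_eqF.
Qed.

(** The part of a large cube on which the exponent may be far from its limit
    at infinity; it is harmless because its measure is a small power of the
    volume. *)
Definition origin_set (eps : R) (Q : cube R n) : set (Rn R n) :=
  [set x | 1 <= cube_edge Q /\ enorm x <= cube_edge Q `^ eps].

Lemma measurable_origin_set eps Q : measurable (origin_set eps Q).
Proof.
rewrite /origin_set; have [h|h] := leP 1 (cube_edge Q); last first.
  rewrite (_ : mkset _ = set0)//.
  by apply/seteqP; split => x //= [].
rewrite (_ : mkset _ = setT `&` (@enorm R n) @^-1` `]-oo, cube_edge Q `^ eps]).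
  exact: measurable_enorm.
by apply/seteqP; split => x /=; rewrite in_itv/= => -[].
Qed.

Lemma lebesgue_origin_set eps Q :
  (lebesgueRn (origin_set eps Q) <= (2 ^+ n * vol Q `^ eps)%:E)%E.
Proof.
have [h|h] := leP 1 (cube_edge Q); last first.
  rewrite (_ : origin_set _ _ = set0) ?measure0; last first.
    by apply/seteqP; split => x //= [+ _]; rewrite leNgt h.
  by rewrite lee_fin mulr_ge0// powR_ge0.
have Q0 : 0 < cube_edge Q by lra.
have -> : origin_set eps Q = [set x | enorm x <= cube_edge Q `^ eps].
  by apply/seteqP; split => x /=; [case|].
apply: le_trans (lebesgueRn_ball_le (powR_gt0 _ Q0)) _.
rewrite lee_fin exprMn /vol -(powR_mulrn n (powR_ge0 _ eps)) -(powR_mulrn n (ltW Q0)).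
by rewrite -!powRrM [eps * _]mulrC.
Qed.

Lemma exists_log_osc_bound (eps : R) : 0 < eps -> exists2 C1, 0 < C1 &
  forall Q x, 0 < cube_edge Q -> cube_set Q x -> ~ origin_set eps Q x ->
  log_osc Q x <= C1.
Proof.
move=> e0.
pose a := n%:R * Cinf / (eps * pm ^+ 2).
pose b := 2 * n%:R * C0 / pm ^+ 2 + 2 * n%:R * ln (2 * n%:R) / pm.
have pm2 : 0 < pm ^+ 2 by rewrite exprn_gt0.
have nR : 1 <= n%:R :> R by rewrite ler1n.
have n0 : 0 < n%:R :> R by lra.
have a0 : 0 < a by rewrite divr_gt0 ?mulr_gt0.
have b0 : 0 <= b.
  have ln2n : 0 <= ln (2 * n%:R) :> R by rewrite ln_ge0//; lra.
  nonneg.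
exists (a + b) => [|Q x Q0 Qx nx]; first by rewrite ltr_wpDr.
have [Q1|Q1] := ltP (cube_edge Q) 1.
  by rewrite (le_trans (log_osc_small Q0 Q1 Qx))// lerDr ltW.
rewrite (le_trans (@log_osc_large Q x eps e0 Q1 _)) ?lerDl//.
by rewrite ltNge; apply/negP => h; apply: nx.
Qed.

(** Stated in this one-sided form, the estimate stays valid when the dilation
    crosses edge 1 and the reference exponent changes: there [ln (vol Q)] is
    negative before the crossing and nonnegative after it, so both terms are
    bounded by their value at exponent [pm]. *)
Lemma ref_exponent_dilate l Q : 1 <= l -> 0 < cube_edge Q ->
  ln (vol (dilate l Q)) / ref_exponent (dilate l Q) - ln (vol Q) / ref_exponent Q
  <= n%:R / pm * ln l.
Proof.
move=> l1 Q0; have l0 : 0 < l by lra.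
have lQ0 : 0 < cube_edge (dilate l Q) by rewrite mulr_gt0.
rewrite !ln_vol//= /ref_exponent /=; set e := cube_edge Q in Q0 *.
have n0 : 0 <= n%:R :> R by [].
have ll : 0 <= ln l by rewrite ln_ge0.
have H (s t r : R) : 0 <= s -> 0 <= t -> pm <= r ->
    n%:R * t / r <= n%:R * t / pm.
  move=> s0 t0 pr; rewrite ler_wpM2l// ?mulr_ge0// lef_pV2 ?posrE//. exact: lt_le_trans pr.
rewrite lnM ?posrE//; case: ifPn => [le1|].
  have -> : e < 1 by apply: le_lt_trans le1; rewrite ler_peMl// ltW.
  rewrite -mulrBl -mulrBr addrK.
  by rewrite [leRHS]mulrAC; apply: (H 0).
rewrite -leNgt => le1; have ln1 : 0 <= ln l + ln e.
  by rewrite -lnM ?posrE// ln_ge0.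
have h1 : n%:R * (ln l + ln e) / rinf <= n%:R * (ln l + ln e) / pm by apply: (H 0).
case: ifPn => [e1|].
  have h2 : n%:R * - ln e / q (cube_center Q) <= n%:R * - ln e / pm.
    by apply: (H 0) => //; rewrite oppr_ge0 ln_le0// ltW.
  rewrite [leRHS]mulrAC; move: h1 h2; rewrite !mulrN !mulNr !mulrDr !mulrDl; lra.
rewrite -leNgt => e1.
rewrite -mulrBl -mulrBr addrK.
by rewrite [leRHS]mulrAC; apply: (H 0).
Qed.

End log_holder.

(** * Bounded mean oscillation along cubes *)

Lemma exists_exponent_between (R : realType) (b l : R) : 1 < b -> 1 <= l ->
  exists k : nat, b ^+ k <= l < b ^+ k.+1.
Proof.
move=> b1 l1; have b0 : 0 < b by lra.
have l0 : 0 < l by lra.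
have lb0 : 0 < ln b by rewrite ln_gt0.
have s0 : 0 <= ln l / ln b by apply: divr_ge0; [exact: ln_ge0|exact: ltW].
have := truncn_itv s0; set k := Num.truncn _ => /andP[h1 h2].
exists k; rewrite -ler_ln ?posrE ?exprn_gt0// -ltr_ln ?posrE ?exprn_gt0// !lnXn//.
by rewrite -[X in X <= _]mulr_natl -[X in _ < X]mulr_natl -ler_pdivlMr// h1/= -ltr_pdivrMr.
Qed.

Section mean_oscillation.
Context {R : realType} {n : nat}.
Local Notation mu := (@lebesgueRn R n).
Implicit Types (P Q : cube R n).
Variables (h : Rn R n -> R) (a : cube R n -> R) (B : R).
Hypothesis mh : measurable_fun setT h.
Hypothesis B_gt0 : 0 < B.
Hypothesis hB : forall Q, 0 < cube_edge Q ->
  (\int[mu]_(x in cube_set Q) `|h x - a Q|%:E <= (B * vol Q)%:E)%E.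

Let mabs c D : measurable_fun D (fun x => `|h x - c|%:E).
Proof.
apply/measurable_EFinP; apply: measurableT_comp; first exact: normr_measurable.
by apply: measurable_funB; [exact: measurable_funTS|exact: measurable_cst].
Qed.

(** Any two constants around which [h] has small mean oscillation on the same
    cube are close. *)
Lemma abs_mean_le P (c d A : R) : 0 < cube_edge P ->
  (\int[mu]_(x in cube_set P) `|h x - c|%:E <= (A * vol P)%:E)%E ->
  (\int[mu]_(x in cube_set P) `|h x - d|%:E <= (B * vol P)%:E)%E ->
  `|c - d| <= A + B.
Proof.
move=> P0 hc hd; have v0 := vol_gt0 P0; have mP := measurable_cube P.
rewrite -(ler_pM2r v0) -lee_fin.
have <- : (\int[mu]_(x in cube_set P) `|c - d|%:E = (`|c - d| * vol P)%:E)%E.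
  by rewrite integral_cst// [X in (_ * X)%E](lebesgue_cube P0) -EFinM.
apply: (@le_trans _ _
    (\int[mu]_(x in cube_set P) (`|h x - c|%:E + `|h x - d|%:E)%E)%E); last first.
  rewrite (ge0_integralD _ mP _ (@mabs c _) _ (@mabs d _)); last 2 first.
  - by move=> x _; rewrite lee_fin.
  - by move=> x _; rewrite lee_fin.
  by rewrite mulrDl EFinD leeD.
apply: (ge0_le_integral _ mP).
- by move=> x _; rewrite lee_fin.
- exact: measurable_cst.
- by apply: emeasurable_funD; exact: mabs.
- move=> x _; rewrite -EFinD lee_fin -[h x - c]opprB normrN.
  by rewrite (_ : c - d = (c - h x) + (h x - d)) ?ler_normD//; ring.
Qed.

Lemma abs_mean_subset_le P Q : 0 < cube_edge P -> 0 < cube_edge Q ->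
  cube_set P `<=` cube_set Q -> `|a Q - a P| <= B * (vol Q / vol P) + B.
Proof.
move=> P0 Q0 PQ; apply: (@abs_mean_le P) => //; last exact: hB.
rewrite -mulrA divfK ?gt_eqF ?vol_gt0//; apply: le_trans (hB Q0).
by apply: ge0_subset_integral => //; exact: measurable_cube.
Qed.

Lemma abs_mean_dilate2_le Q l : 0 < cube_edge Q -> 1 <= l <= 2 ->
  `|a (dilate l Q) - a Q| <= B * (2 ^+ n + 1).
Proof.
move=> Q0 /andP[l1 l2]; have lQ0 : 0 < cube_edge (dilate l Q).
  by rewrite mulr_gt0//; lra.
apply: le_trans (abs_mean_subset_le Q0 lQ0 (sub_dilate l1 Q0)) _.
rewrite mulrDr mulr1 lerD2r ler_wpM2l ?(ltW B_gt0)//.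
rewrite vol_dilate mulfK ?gt_eqF ?vol_gt0// lerXn2r// nnegrE; lra.
Qed.

(** Doubling the cube moves the centre value by a bounded amount, and [l] is
    reached by logarithmically many doublings. *)
Lemma abs_mean_dilate_le Q l : 0 < cube_edge Q -> 1 <= l ->
  `|a (dilate l Q) - a Q| <= B * (2 ^+ n + 1) * (1 + ln l / ln 2).
Proof.
move=> Q0 l1; have B0 : 0 <= B * (2 ^+ n + 1) by nonneg.
have H k : forall (l : R) Q, 0 < cube_edge Q -> 1 <= l -> l < 2 ^+ k.+1 ->
   `|a (dilate l Q) - a Q| <= B * (2 ^+ n + 1) * k.+1%:R.
  elim: k => [|k ih] {Q0 l1} {}l {}Q Q0 l1 l2.
    by rewrite mulr1 abs_mean_dilate2_le// l1 ltW.
  have [le2|gt2] := leP l 2.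
    apply: le_trans (abs_mean_dilate2_le Q0 _) _; first by rewrite l1.
    by rewrite ler_peMr// ler1n.
  have Q20 : 0 < cube_edge (dilate 2 Q) by rewrite mulr_gt0.
  have := ih (l / 2) (dilate 2 Q) Q20; rewrite dilateM divfK//.
  have -> : 1 <= l / 2 by lra.
  have -> : l / 2 < 2 ^+ k.+1 by rewrite ltr_pdivrMr// -exprSr.
  move=> /(_ isT isT) h1.
  have h2 : `|a (dilate 2 Q) - a Q| <= B * (2 ^+ n + 1).
    by apply: abs_mean_dilate2_le => //; lra.
  rewrite -[k.+2%:R]natr1 [leRHS]mulrDr [_ * 1]mulr1.
  rewrite (_ : _ - _ = (a (dilate l Q) - a (dilate 2 Q)) + (a (dilate 2 Q) - a Q)); last ring.
  by apply: le_trans (ler_normD _ _) _; exact: lerD.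
have [k /andP[k1 k2]] := @exists_exponent_between R 2 l (ltr1n _ 2) l1.
apply: le_trans (H k l Q Q0 l1 k2) _; apply: ler_wpM2l => //.
have ln2 : 0 < ln 2 :> R by rewrite ln_gt0// ltr1n.
rewrite -[k.+1%:R]natr1 addrC lerD2l ler_pdivlMr// mulr_natl -lnXn// ler_ln ?posrE ?exprn_gt0//.
by lra.
Qed.

(** No logarithmic growth can hold at all cubes, in either direction: some
    small subcube [Q] of the unit cube [P] has a centre value close to that of
    [P], while [2 * M] times [Q] contains [P] and has comparable volume. *)
Lemma exists_cube_stable_dilate (M : nat) : (0 < M)%N ->
  exists Q, 0 < cube_edge Q /\
    `|a (dilate (2 * M%:R) Q) - a Q| <= B * (2 ^+ n + 4).
Proof.
move=> M0; have MR : 0 < M%:R :> R by rewrite ltr0n.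
pose c : Rn R n := point_of (fun=> 0).
pose P := Cube c 1 (fun=> true) (fun=> false).
have P0 : 0 < cube_edge P by [].
have [f hf] := exists_subcube_le M0 P0 B_gt0 (@mabs (a P) setT)
  (fun x => normr_ge0 _) (hB P0).
set Q := subcube c 1 f in hf; exists Q.
have Q0 : 0 < cube_edge Q by rewrite /= divr_gt0.
split=> //.
have MQ0 : 0 < cube_edge (dilate (2 * M%:R) Q) by rewrite mulr_gt0// mulr_gt0.
have h1 : `|a P - a Q| <= 2 * B + B by apply: abs_mean_le Q0 hf (hB Q0).
have PQ : cube_set P `<=` cube_set (dilate (2 * M%:R) Q).
  apply: cube_subset => i; rewrite !coord_point_of /=.
  have i1 : 0 < M%:R^-1 :> R by rewrite invr_gt0.
  have hM : (M%:R * M%:R^-1 : R) = 1 by rewrite divff ?gt_eqF.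
  have hi : (f i)%:R * M%:R^-1 + M%:R^-1 <= 1 :> R.
    by rewrite -[X in _ + X]mul1r -mulrDl -[leRHS]hM ler_pM2r// natr1 ler_nat.
  have : 0 <= (f i)%:R * M%:R^-1 :> R by rewrite mulr_ge0// ltW.
  rewrite !div1r -[2 * M%:R * _]mulrA hM mulr1.
  set z := M%:R^-1 in hi i1 *.
  have -> : 0 - (0 - 2^-1 + ((f i)%:R + 2^-1) * z) = 1 / 2 - (f i)%:R * z - z / 2 by field.
  set y := _%:R * z in hi *; move=> y0.
  by have : `|1 / 2 - y - z / 2| < 1 / 2; [rewrite ltr_norml; lra | lra].
have := abs_mean_subset_le P0 MQ0 PQ.
rewrite vol_dilate /vol /= expr1n divr1 -exprMn div1r mulfK ?gt_eqF// => h2.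
rewrite (_ : _ - _ = (a (dilate (2 * M%:R) Q) - a P) + (a P - a Q)); last ring.
apply: le_trans (ler_normD _ _) _; lra.
Qed.

End mean_oscillation.

(** A fixed gain at each tripling becomes a power of the dilation factor. *)
Lemma gain_dilate (R : realType) (n : nat) (f : cube R n -> R) (d : R) :
  0 <= d ->
  (forall Q l m, 0 < cube_edge Q -> 0 < l -> l <= m -> f (dilate l Q) <= f (dilate m Q)) ->
  (forall Q, 0 < cube_edge Q -> f Q <= f (dilate 3 Q) - d) ->
  forall Q l, 0 < cube_edge Q -> 1 <= l ->
    f Q <= f (dilate l Q) - d * (ln l / ln 3 - 1).
Proof.
move=> d0 mono step Q l Q0 l1.
have H k : f Q <= f (dilate (3 ^+ k) Q) - d * k%:R.
  elim: k => [|k ih]; first by rewrite expr0 dilate1 mulr0 subr0.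
  have kQ0 : 0 < cube_edge (dilate (3 ^+ k) Q) by rewrite mulr_gt0// exprn_gt0.
  have := step _ kQ0; rewrite dilateM -exprS => h.
  rewrite -[k.+1%:R]natr1 [d * _]mulrDr; lra.
have [k /andP[k1 k2]] := @exists_exponent_between R 3 l (ltr1n _ 3) l1.
have k0 : 0 < 3 ^+ k :> R by rewrite exprn_gt0.
have h1 := mono Q _ _ Q0 k0 k1.
have ln3 : 0 < ln 3 :> R by rewrite ln_gt0// ltr1n.
have h2 : ln l / ln 3 - 1 <= k%:R.
  have l0 : 0 < l by lra.
  rewrite lerBlDr natr1 ler_pdivrMr// mulr_natl -lnXn// ler_ln ?posrE ?exprn_gt0//.
  exact: ltW.
have h3 := ler_wpM2l d0 h2.
have := H k; lra.
Qed.

(** * The variable-exponent quasi-norm on a set *)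

Lemma measurable_fun_powR2 d (T : measurableType d) (R : realType) (f g : T -> R) :
  measurable_fun setT f -> measurable_fun setT g ->
  measurable_fun setT (fun x => f x `^ g x).
Proof.
move=> mf mg; rewrite /powR; apply: measurable_fun_ifT.
- exact: measurable_fun_eqr.
- rewrite (_ : (fun x => _) = (fun x => if g x == 0 then 1 else 0)).
    by apply: measurable_fun_ifT => //; exact: measurable_fun_eqr.
  by apply/funext => x; case: eqP.
- apply: measurableT_comp => //; apply: measurable_funM => //.
  exact: measurableT_comp.
Qed.

Lemma le_integral_indic d (T : measurableType d) (R : realType)
    (mu : {measure set T -> \bar R}) (A E : set T) (f : T -> R) (a b : R) :
  measurable A -> measurable E -> measurable_fun A f -> 0 <= a -> 0 <= b ->
  (forall x, A x -> 0 <= f x <= a + b * \1_E x) ->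
  (\int[mu]_(x in A) (f x)%:E <= a%:E * mu A + b%:E * mu E)%E.
Proof.
move=> mA mE mf a0 b0 h.
have mI : measurable_fun A (fun x => (\1_E x : R)%:E).
  by apply/measurable_EFinP; exact: measurable_indic.
apply: (@le_trans _ _ (\int[mu]_(x in A) (a%:E + b%:E * (\1_E x)%:E)%E)%E).
  apply: ge0_le_integral => //.
  - by move=> x Ax; rewrite lee_fin; case/andP: (h x Ax).
  - exact/measurable_EFinP.
  - by apply: emeasurable_funD => //; exact: measurable_funeM.
  - by move=> x Ax; rewrite -EFinM -EFinD lee_fin; case/andP: (h x Ax).
rewrite ge0_integralD//=; last 2 first.
- by move=> x _; rewrite mule_ge0 ?lee_fin.
- exact: measurable_funeM.
rewrite integral_cst// leeD2l// ge0_integralZl//.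
rewrite lee_wpmul2l ?lee_fin// integral_indic//.
by apply: le_measure; rewrite ?inE//; exact: measurableI.
Qed.

Section variable_norm.
Context {R : realType} {n : nat}.
Local Notation mu := (@lebesgueRn R n).
Variables (p : Rn R n -> \bar R) (q : Rn R n -> R) (pm pM : R).
Hypothesis pE : forall x, p x = (q x)%:E.
Hypothesis mq : measurable_fun setT q.
Hypothesis pm_gt0 : 0 < pm.
Hypothesis q_ge : forall x, pm <= q x.
Hypothesis q_le : forall x, q x <= pM.
Implicit Types (u v : Rn R n -> R) (A : set (Rn R n)).

Definition restr_norm u A : \bar R := vnorm p (fun x => u x * \1_A x).

Definition pow_integral u A (l : R) : \bar R :=
  (\int[mu]_(x in A) ((u x / l) `^ q x)%:E)%E.

Let q_gt0 x : 0 < q x. Proof. exact: lt_le_trans (q_ge x). Qed.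

Lemma modular_restr u A l : (forall x, 0 <= u x) -> 0 < l ->
  modular p (fun x => u x * \1_A x / l) = pow_integral u A l.
Proof.
move=> u0 l0; rewrite /modular /pow_integral [RHS]integral_mkcond.
apply: eq_integral => x _; rewrite pE patchE /= indicE.
case: ifPn => xA; rewrite ?mulr1 ?mulr0 ?mul0r.
  by rewrite ger0_norm// divr_ge0// ltW.
by rewrite normr0 powR0// gt_eqF.
Qed.

Lemma measurable_pow u l : measurable_fun setT u ->
  measurable_fun setT (fun x => (u x / l) `^ q x).
Proof.
move=> mu'; apply: measurable_fun_powR2; last exact: mq.
by apply: measurable_funM; [exact: mu'|exact: measurable_cst].
Qed.

Lemma measurable_pow_integrand u A l : measurable_fun setT u ->
  measurable_fun A (fun x => ((u x / l) `^ q x)%:E).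
Proof.
by move=> mu'; apply/measurable_EFinP/measurable_funTS; exact: measurable_pow.
Qed.

Lemma pow_integrand_ge0 u A l x : A x -> (0 <= ((u x / l) `^ q x)%:E)%E.
Proof. by rewrite lee_fin powR_ge0. Qed.

Lemma pow_integral_le u A l1 l2 : measurable A -> measurable_fun setT u ->
  (forall x, 0 <= u x) -> 0 < l1 -> l1 <= l2 ->
  (pow_integral u A l2 <= pow_integral u A l1)%E.
Proof.
move=> mA mu' u0 l10 l12; have l20 : 0 < l2 by lra.
rewrite /pow_integral; apply: (ge0_le_integral _ mA (@pow_integrand_ge0 _ _ _)
  (measurable_pow_integrand _ mu') (measurable_pow_integrand _ mu')).
move=> x _; rewrite lee_fin ge0_ler_powR ?nnegrE ?(ltW (q_gt0 x)) ?divr_ge0 ?(ltW l10) ?(ltW l20)//.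
  by rewrite ler_wpM2l// lef_pV2.
Qed.

(** Since the exponent is bounded, dividing by a small [c] costs a finite
    factor. *)
Lemma pow_integral_scale u A l c : measurable A -> measurable_fun setT u ->
  (forall x, 0 <= u x) -> 0 < l -> 0 < c <= 1 ->
  (pow_integral u A (c * l) <= (c `^ (- pM))%:E * pow_integral u A l)%E.
Proof.
move=> mA mu' u0 l0 /andP[c0 c1]; rewrite /pow_integral.
have k0 : (0 <= (c `^ (- pM))%:E)%E by rewrite lee_fin powR_ge0.
have mp t := measurable_pow_integrand (A := A) t mu'.
have p0 t := @pow_integrand_ge0 u A t.
rewrite -(ge0_integralZl mu mA (mp l) (p0 l) k0).
apply: (ge0_le_integral _ mA (p0 _) (mp _)).
  exact: measurable_funeM.
- move=> x _; rewrite -EFinM lee_fin invfM mulrA [u x / c]mulrC -mulrA.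
  rewrite powRM ?invr_ge0 ?divr_ge0 ?(ltW c0) ?(ltW l0)// ler_wpM2r ?powR_ge0//.
  rewrite -powR_inv1 ?(ltW c0)// -powRrM mulN1r.
  by apply: ger_powR; rewrite ?c0// lerN2.
Qed.

Lemma restr_norm_ge0 u A : (0 <= restr_norm u A)%E.
Proof. by apply: le_ereal_inf_tmp => _ [l [l0 _] <-]; rewrite lee_fin ltW. Qed.

Lemma restr_norm_le u A l : (forall x, 0 <= u x) -> 0 < l ->
  (pow_integral u A l <= 1)%E -> (restr_norm u A <= l%:E)%E.
Proof.
by move=> u0 l0 h; apply: ereal_inf_lbound; exists l => //=; rewrite modular_restr.
Qed.

(** The strict hypothesis avoids a limit at the infimum itself; the slack is
    absorbed by the constants. *)
Lemma lt_restr_norm u A l : measurable A -> measurable_fun setT u ->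
  (forall x, 0 <= u x) -> (restr_norm u A < l%:E)%E ->
  (pow_integral u A l <= 1)%E.
Proof.
move=> mA mu' u0 /ereal_inf_lt [_ [l' [l'0 hl'] <-]].
rewrite lte_fin => l'l; rewrite (modular_restr A u0 l'0) in hl'.
exact: le_trans (pow_integral_le mA mu' u0 l'0 (ltW l'l)) hl'.
Qed.

Lemma restr_norm_mono u v A B c : measurable A -> measurable B -> A `<=` B ->
  measurable_fun setT v ->
  measurable_fun setT u -> (forall x, 0 <= u x) -> (forall x, 0 <= v x) -> 0 < c ->
  (forall x, A x -> u x <= c * v x) ->
  (restr_norm u A <= c%:E * restr_norm v B)%E.
Proof.
move=> mA mB AB mv mu' u0 v0 c0 uv.
rewrite -(lee_pdivrMl _ _ c0); apply: le_ereal_inf_tmp => _ [l [l0 hl] <-].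
rewrite (modular_restr B v0 l0) in hl.
rewrite (lee_pdivrMl _ _ c0) -EFinM.
apply: (restr_norm_le u0 (mulr_gt0 c0 l0)); apply: le_trans hl.
apply: (@le_trans _ _ (pow_integral v A l)).
  rewrite /pow_integral; apply: (ge0_le_integral _ mA (@pow_integrand_ge0 _ _ _)
    (measurable_pow_integrand _ mu') (measurable_pow_integrand _ mv)).
  move=> x Ax; rewrite lee_fin ge0_ler_powR ?nnegrE ?(ltW (q_gt0 x)) ?divr_ge0 ?mulr_ge0 ?(ltW l0) ?(ltW c0)//.
    rewrite ler_pdivrMr ?mulr_gt0//.
    have -> : v x / l * (c * l) = c * v x by field; rewrite gt_eqF.
    exact: uv.
rewrite /pow_integral; exact: (ge0_subset_integral _ mA mB (measurable_pow_integrand _ mv)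
  (@pow_integrand_ge0 _ _ _) AB).
Qed.

(** A vanishing norm would make the integral of [u `^ q] at most [c `^ pm] for
    every small [c]. *)
Lemma restr_norm_gt0 u A : measurable A -> (0 < mu A)%E -> measurable_fun setT u ->
  (forall x, 0 <= u x) -> {ae mu, forall x, 0 < u x} -> (0 < restr_norm u A)%E.
Proof.
move=> mA A0 mu' u0 upos; rewrite lt0e restr_norm_ge0 andbT; apply/eqP => F0.
have mp t := measurable_pow_integrand (A := A) t mu'.
have p0 t := @pow_integrand_ge0 u A t.
have H c : 0 < c <= 1 -> (pow_integral u A 1 <= (c `^ pm)%:E)%E.
  move=> /andP[c0 c1].
  have h1 : (pow_integral u A c <= 1)%E.
    by apply: lt_restr_norm => //; rewrite F0 lte_fin.
  rewrite -[leRHS]mule1; apply: le_trans (lee_wpmul2l _ h1); last by rewrite lee_fin powR_ge0.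
  have k0 : (0 <= (c `^ pm)%:E)%E by rewrite lee_fin powR_ge0.
  rewrite /pow_integral -(ge0_integralZl _ mA (mp c) (p0 c) k0).
  apply: (ge0_le_integral _ mA (p0 _) (mp _)).
    exact: measurable_funeM.
  - move=> x _; rewrite -EFinM lee_fin divr1.
    have -> : u x `^ q x = c `^ q x * (u x / c) `^ q x.
      by rewrite -powRM ?(ltW c0) ?divr_ge0 ?(ltW c0)// mulrC divfK ?gt_eqF.
    rewrite ler_wpM2r ?powR_ge0//; apply: ger_powR => //.
    by rewrite c0.
have I0 : pow_integral u A 1 = 0%E.
  apply/eqP; rewrite eq_le; apply/andP; split; last first.
    by apply: integral_ge0 => x _; rewrite lee_fin powR_ge0.
  apply/lee_addgt0Pr => e e0; rewrite add0e.
  pose c := Num.min 1 (e `^ pm^-1).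
  have c0 : 0 < c by rewrite lt_min ltr01 powR_gt0.
  apply: le_trans (H c _) _; first by rewrite c0 ge_min lexx.
  have -> : e = (e `^ pm^-1) `^ pm.
    by rewrite -powRrM mulVf ?gt_eqF// powRr1// ltW.
  rewrite lee_fin.
  rewrite ge0_ler_powR ?nnegrE ?(ltW pm_gt0) ?(ltW c0) ?powR_ge0//.
  by rewrite ge_min lexx orbT.
have : ae_eq mu A (fun x => ((u x / 1) `^ q x)%:E) (cst 0%E).
  apply/(ae_eq_integral_abs _ mA (mp 1)); rewrite -[RHS]I0.
  by apply: eq_integral => x _; rewrite gee0_abs// lee_fin powR_ge0.
move=> h; have : (mu A <= 0)%E; last by rewrite leNgt A0.
have [N [mN N0 hN]] : {ae mu, forall x, ~ A x}.
  apply: filterS2 upos h => x ux hx Ax; move: (hx Ax) => /= [].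
  by move/eqP; rewrite divr1 powR_eq0 gt_eqF.
rewrite -N0; apply: le_measure; rewrite ?inE// => x Ax; apply: hN => /=; exact.
Qed.

End variable_norm.

(** * Norms of indicators of cubes *)

Section cube_norm.
Context {R : realType} {n : nat}.
Local Notation mu := (@lebesgueRn R n).
Variables (p : Rn R n -> \bar R) (q : Rn R n -> R) (pm pM C0 rinf Cinf : R).
Hypothesis n_gt0 : (0 < n)%N.
Hypothesis pE : forall x, p x = (q x)%:E.
Hypothesis mq : measurable_fun setT q.
Hypothesis pm_gt0 : 0 < pm.
Hypothesis q_ge : forall x, pm <= q x.
Hypothesis q_le : forall x, q x <= pM.
Hypothesis C0_gt0 : 0 < C0.
Hypothesis LH0 : forall x y, Defs.edist x y < 2^-1 ->
        `|q x - q y| <= - (C0 / ln (Defs.edist x y)).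
Hypothesis rinf_ge : pm <= rinf.
Hypothesis rinf_le : rinf <= pM.
Hypothesis Cinf_gt0 : 0 < Cinf.
Hypothesis LHinf : forall x, `|q x - rinf| <= Cinf / ln (expR 1 + enorm x).
Implicit Types (Q : cube R n).

Local Notation r_ := (ref_exponent q rinf).
Local Notation osc := (log_osc q rinf).
Local Notation restr_norm := (restr_norm p).
Local Notation pow_integral := (pow_integral q).

Let pM_gt0 : 0 < pM.
Proof. exact: lt_le_trans pm_gt0 (le_trans (q_ge point) (q_le point)). Qed.

Let pm_le_pM : pm <= pM.
Proof. exact: le_trans (q_ge point) (q_le point). Qed.

(* Small enough both for [eps <= 1/2] and for [eps < pm / pM]. *)
Let eps : R := pm / (2 * pM).

Let eps_gt0 : 0 < eps. Proof. by rewrite /eps divr_gt0// mulr_gt0. Qed.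

Let eps_le : eps <= 2^-1.
Proof.
rewrite /eps ler_pdivrMr ?mulr_gt0// mulrA mulVf ?mul1r// pnatr_eq0.
Qed.

Lemma ref_exponent_bounds Q : pm <= r_ Q <= pM.
Proof. by rewrite /ref_exponent; case: ifP => _; rewrite ?q_ge ?q_le ?rinf_ge. Qed.

Lemma origin_set_small Q : cube_edge Q < 1 -> origin_set eps Q = set0.
Proof. by move=> Q1; apply/seteqP; split => x //= [+ _]; rewrite leNgt Q1. Qed.

Lemma measurable_log_osc Q : measurable_fun setT (osc Q).
Proof.
have mV : measurable_fun setT (fun x => (q x)^-1).
  have -> : (fun x => (q x)^-1) = (fun x => expR (- ln (q x))).
    by apply/funext => x; rewrite expRN lnK// posrE (lt_le_trans pm_gt0).
  apply: measurableT_comp; first exact: measurable_expR.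
  apply: measurableT_comp; first exact: oppr_measurable.
  exact: (measurableT_comp (@measurable_ln R) mq).
apply: measurable_funM; first exact: measurable_cst.
apply: measurableT_comp; first exact: normr_measurable.
by apply: measurable_funB; [exact: mV|exact: measurable_cst].
Qed.

Lemma log_osc_ge0 Q x : 0 <= osc Q x.
Proof. exact: mulr_ge0. Qed.

(** On the exceptional set the oscillation is at most [ln (vol Q) / pm], and
    [ln v * v `^ eps <= 2 * v] because [eps <= 1/2]. *)
Lemma mean_log_osc_le : exists2 C, 0 < C & forall Q, 0 < cube_edge Q ->
  (\int[mu]_(x in cube_set Q) (osc Q x)%:E <= (C * vol Q)%:E)%E.
Proof.
have [C1 C10 hC1] := exists_log_osc_bound n_gt0 pm_gt0 q_ge C0_gt0 LH0 rinf_ge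
  Cinf_gt0 LHinf eps_gt0.
exists (C1 + 2 / pm * 2 ^+ n) => [|Q Q0].
  by rewrite addr_gt0// mulr_gt0// ?divr_gt0// exprn_gt0.
have v0 := vol_gt0 Q0.
have mQ := measurable_cube Q; have mE := measurable_origin_set eps Q.
apply: le_trans (le_integral_indic (a := C1) (b := `|ln (vol Q)| / pm) _ mQ mE _ _ _ _) _.
- exact/measurable_funTS/measurable_log_osc.
- exact: ltW.
- by rewrite divr_ge0// ltW.
- move=> x Qx; rewrite log_osc_ge0/= indicE.
  have lp : 0 <= `|ln (vol Q)| / pm by rewrite divr_ge0// ltW.
  have [xE|/negP xE] := boolP (x \in origin_set eps Q); last first.
    rewrite mulr0 addr0; apply: (hC1 Q x) => //.
    by move=> h; apply: xE; rewrite inE.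
  rewrite mulr1 (@le_trans _ _ (`|ln (vol Q)| / pm)) ?lerDr ?(ltW C10)//.
  apply: ler_wpM2l => //; apply: normr_invB_le => //.
  by case/andP: (ref_exponent_bounds Q).
rewrite [X in (_ * X + _)%E](lebesgue_cube Q0) -EFinM mulrDl EFinD leeD2l//.
have [Q1|Q1] := ltP (cube_edge Q) 1.
  rewrite origin_set_small// measure0 mule0 lee_fin.
  by nonneg.
have v1 : 1 <= vol Q by rewrite /vol exprn_ege1.
have lp : 0 <= `|ln (vol Q)| / pm by rewrite divr_ge0// ltW.
apply: le_trans (lee_wpmul2l _ (lebesgue_origin_set eps Q)) _; first by rewrite lee_fin.
rewrite -EFinM lee_fin ger0_norm ?ln_ge0//.
have ln_le : ln (vol Q) <= 2 * vol Q `^ 2^-1.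
  have := ln_sublinear (powR_gt0 2^-1 v0); rewrite ln_powR; lra.
have he : vol Q `^ eps <= vol Q `^ 2^-1 by apply: ler_powR.
have hv : vol Q `^ 2^-1 * vol Q `^ 2^-1 = vol Q.
  rewrite -powRD; last by rewrite gt_eqF ?implybT.
  by rewrite (_ : 2^-1 + 2^-1 = 1 :> R) ?powRr1 ?(ltW v0)//; field.
have key : ln (vol Q) * vol Q `^ eps <= 2 * vol Q.
  by rewrite -{3}hv mulrA; apply: ler_pM => //; rewrite ?powR_ge0 ?ln_ge0.
have K0 : 0 <= 2 ^+ n / pm by nonneg.
have := ler_wpM2l K0 key.
by move: (pm^-1) => i; lra.
Qed.

Let one_ge0 (x : Rn R n) : 0 <= (1 : R). Proof. by []. Qed.
Let measurable_one : measurable_fun setT (fun _ : Rn R n => (1 : R)).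
Proof. exact: measurable_cst. Qed.

Lemma vnorm_indic A : vnorm p \1_A = restr_norm (fun=> 1%R) A.
Proof. by congr vnorm; apply/funext => x; rewrite mul1r. Qed.

Lemma inv_expR_powR s x : (1 / expR s) `^ q x = expR (- (s * q x)).
Proof. by rewrite div1r -expRN -expRM mulNr. Qed.

(** Jensen's inequality in the form [1 + t <= expR t], applied under the
    integral. *)
Lemma pow_integral_one_ge C Q s : 0 < cube_edge Q ->
  (\int[mu]_(x in cube_set Q) (osc Q x)%:E <= (C * vol Q)%:E)%E ->
  (pow_integral (fun=> 1%R) (cube_set Q) (expR s) <= 1)%E ->
  ln (vol Q) / r_ Q - pM * C / pm <= s.
Proof.
move=> Q0 hC h1; have v0 := vol_gt0 Q0; have mQ := measurable_cube Q.
have [/andP[r1 r2]] := ref_exponent_bounds Q.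
have r0 : 0 < r_ Q by exact: lt_le_trans r1.
set L := ln (vol Q); set t := L / r_ Q - s.
suff ht : t * pm <= pM * C.
  by rewrite lerBlDr -lerBlDl -/t ler_pdivlMr.
have [t0|t0] := leP t 0.
  have C0' : 0 <= C * vol Q.
    rewrite -lee_fin; apply: le_trans hC; apply: integral_ge0 => x _.
    by rewrite lee_fin log_osc_ge0.
  have C0'' : 0 <= C by move: C0'; rewrite pmulr_lge0.
  apply: (@le_trans _ _ 0); last by rewrite mulr_ge0// ltW.
  by rewrite mulr_le0_ge0// ltW.
have key x : (1 + t * pm) <= vol Q * (1 / expR s) `^ q x + pM * osc Q x.
  rewrite inv_expR_powR -{1}[vol Q]lnK ?posrE// -/L -expRD.
  have := expR_ge1Dx (L - s * q x).
  have q0 : 0 < q x := lt_le_trans pm_gt0 (q_ge x).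
  have -> : L - s * q x = q x * (L * ((q x)^-1 - (r_ Q)^-1)) + t * q x.
    by rewrite /t; field; rewrite !gt_eqF.
  have h2 : - (L * ((q x)^-1 - (r_ Q)^-1)) <= osc Q x.
    by rewrite /log_osc -/L -normrM -normrN; exact: ler_norm.
  have h3 : q x * osc Q x <= pM * osc Q x by rewrite ler_wpM2r ?log_osc_ge0.
  have h4 : q x * - (L * ((q x)^-1 - (r_ Q)^-1)) <= q x * osc Q x.
    by rewrite ler_wpM2l// ltW.
  have h5 : t * pm <= t * q x by rewrite ler_pM2l.
  move: h4; rewrite mulrN; lra.
have mp := measurable_pow_integrand (A := cube_set Q) mq (expR s) measurable_one.
have mo : measurable_fun (cube_set Q) (fun x => (osc Q x)%:E).
  exact/measurable_EFinP/measurable_funTS/measurable_log_osc.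
have p0 := @pow_integrand_ge0 _ _ q (fun=> 1%R) (cube_set Q) (expR s).
have o0 x : cube_set Q x -> (0 <= (osc Q x)%:E)%E by rewrite lee_fin log_osc_ge0.
have : ((1 + t * pm) * vol Q <= vol Q * 1 + pM * (C * vol Q)).
  rewrite -lee_fin EFinD EFinM.
  apply: (@le_trans _ _ ((vol Q)%:E * pow_integral (fun=> 1%R) (cube_set Q) (expR s) +
     pM%:E * \int[mu]_(x in cube_set Q) (osc Q x)%:E)%E); last first.
    by rewrite leeD// EFinM lee_wpmul2l// ?lee_fin ltW.
  rewrite -[X in (_ * X <= _)%E](lebesgue_cube Q0) -(integral_cst mu mQ).
  have v0' : (0 <= (vol Q)%:E)%E by rewrite lee_fin ltW.
  have pM0' : (0 <= pM%:E)%E by rewrite lee_fin ltW.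
  rewrite /pow_integral -(ge0_integralZl _ mQ mp p0 v0') -(ge0_integralZl _ mQ mo o0 pM0').
  have mp' := measurable_funeM (vol Q)%:E mp.
  have mo' := measurable_funeM pM%:E mo.
  rewrite -(ge0_integralD _ mQ _ mp' _ mo'); last 2 first.
  - by move=> x Qx; rewrite mule_ge0// p0.
  - by move=> x Qx; rewrite mule_ge0// o0.
  apply: (ge0_le_integral _ mQ).
  - by move=> x _; rewrite lee_fin addr_ge0// mulr_ge0// ltW.
  - exact: measurable_cst.
  - exact: emeasurable_funD.
  - by move=> x _; rewrite -!EFinM -EFinD lee_fin.
rewrite (_ : vol Q * 1 + _ = (1 + pM * C) * vol Q); last ring.
by rewrite ler_pM2r// lerD2l.
Qed.

(** Off the exceptional set the integrand exceeds [(vol Q)^-1] by a bounded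
    factor.  On that set the integrand may be as large as
    [vol Q `^ (- pm / pM)], which is compensated by the measure
    [vol Q `^ eps] since [eps < pm / pM]. *)
Lemma pow_integral_one_le : exists2 k, 0 <= k & forall Q, 0 < cube_edge Q ->
  (pow_integral (fun=> 1%R) (cube_set Q) (expR (ln (vol Q) / r_ Q + k)) <= 1)%E.
Proof.
have [C1 C10 hC1] := exists_log_osc_bound n_gt0 pm_gt0 q_ge C0_gt0 LH0 rinf_ge
  Cinf_gt0 LHinf eps_gt0.
pose K := expR (pM * C1) + 2 ^+ n.
have K1 : 1 <= K.
  have : 0 < 2 ^+ n :> R by rewrite exprn_gt0.
  have : 1 <= expR (pM * C1).
    by rewrite -[leLHS]expR0 ler_expR mulr_ge0// ltW.
  rewrite /K; lra.
have K0 : 0 < K by lra.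
exists (ln K / pm) => [|Q Q0].
  by rewrite divr_ge0 ?ln_ge0// ltW.
have v0 := vol_gt0 Q0; have mQ := measurable_cube Q.
have mE := measurable_origin_set eps Q.
have [/andP[r1 r2]] := ref_exponent_bounds Q.
have r0 : 0 < r_ Q by exact: lt_le_trans r1.
set L := ln (vol Q); set s := L / r_ Q + _.
have vE : vol Q = expR L by rewrite lnK.
pose a := K^-1 / vol Q * expR (pM * C1).
pose b := K^-1 / vol Q * expR (L * (1 - pm / pM)).
have Kv : 0 < K^-1 / vol Q by rewrite divr_gt0// invr_gt0.
have base x : (1 / expR s) `^ q x <= K^-1 / vol Q * expR (L * (1 - q x / r_ Q)).
  have q0 : 0 < q x := lt_le_trans pm_gt0 (q_ge x).
  rewrite inv_expR_powR -{1}[K]lnK ?posrE// vE -!expRN -!expRD ler_expR.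
  have : ln K <= ln K / pm * q x.
    by rewrite -mulrA ler_peMr ?ln_ge0// mulrC ler_pdivlMr// mul1r.
  rewrite /s mulrDl.
  have -> : L * (1 - q x / r_ Q) = L - L / r_ Q * q x by field; rewrite gt_eqF.
  lra.
have ab x : cube_set Q x ->
    0 <= (1 / expR s) `^ q x <= a + b * \1_(origin_set eps Q) x.
  move=> Qx; rewrite powR_ge0/=; apply: le_trans (base x) _.
  have q0 : 0 < q x := lt_le_trans pm_gt0 (q_ge x).
  have a0 : 0 < a by rewrite mulr_gt0// expR_gt0.
  have b0 : 0 < b by rewrite mulr_gt0// expR_gt0.
  rewrite indicE; have [xE|/negP xE] := boolP (x \in origin_set eps Q); last first.
    rewrite mulr0 addr0 ler_pM2l// ler_expR.
    have xE' : ~ origin_set eps Q x by move=> h; apply: xE; rewrite inE.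
    have -> : L * (1 - q x / r_ Q) = q x * (L * ((q x)^-1 - (r_ Q)^-1)).
      by field; rewrite !gt_eqF.
    have h1 : L * ((q x)^-1 - (r_ Q)^-1) <= C1.
      apply: le_trans (hC1 Q x Q0 Qx xE').
      by rewrite /log_osc -/L -normrM; exact: ler_norm.
    apply: (@le_trans _ _ (q x * C1)); first by rewrite ler_pM2l.
    by rewrite ler_pM2r.
  rewrite mulr1 (@le_trans _ _ b) ?lerDr ?(ltW a0)// /b ler_pM2l// ler_expR.
  move: xE; rewrite inE => -[Q1 _].
  apply: ler_wpM2l; first by rewrite ln_ge0// /vol exprn_ege1.
  rewrite lerD2l lerN2; apply: ler_pM => //; rewrite ?invr_ge0 ?(ltW pm_gt0) ?(ltW pM_gt0)//.
  by rewrite lef_pV2.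
have mp : measurable_fun (cube_set Q) (fun x => (1 / expR s) `^ q x).
  by apply: measurable_funTS; exact: measurable_pow.
have a0 : 0 <= a by rewrite mulr_ge0 ?expR_ge0// ltW.
have b0 : 0 <= b by rewrite mulr_ge0 ?expR_ge0// ltW.
apply: le_trans (le_integral_indic _ mQ mE mp a0 b0 ab) _.
rewrite [X in (_ * X + _)%E](lebesgue_cube Q0) -EFinM.
have av : a * vol Q = K^-1 * expR (pM * C1) by rewrite /a mulrAC divfK ?gt_eqF.
rewrite av; have [Q1|Q1] := ltP (cube_edge Q) 1.
  rewrite origin_set_small// measure0 mule0 adde0 lee_fin mulrC ler_pdivrMr// mul1r.
  by rewrite /K lerDl.
apply: (@le_trans _ _ ((K^-1 * expR (pM * C1))%:E + b%:E * (2 ^+ n * vol Q `^ eps)%:E)%E).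
  by rewrite leeD2l// lee_wpmul2l ?lee_fin// lebesgue_origin_set.
rewrite -EFinM -EFinD lee_fin.
have bv : b * (2 ^+ n * vol Q `^ eps) <= K^-1 * 2 ^+ n.
  rewrite /b vE -expRM -!mulrA ler_pM2l ?invr_gt0//.
  rewrite -expRN; set e1 := expR (- L); set e2 := expR (L * (1 - _)); set e3 := expR (L * eps).
  rewrite (_ : e1 * _ = 2 ^+ n * (e1 * e2 * e3)); last ring.
  rewrite ler_piMr ?exprn_ge0// /e1 /e2 /e3 -!expRD expR_le1.
  rewrite (_ : _ + _ = - (L * (pm / pM) / 2)); last first.
    by rewrite /eps; field; rewrite gt_eqF.
  rewrite oppr_le0 divr_ge0// mulr_ge0//; first by rewrite ln_ge0// /vol exprn_ege1.
  by rewrite divr_ge0// ltW.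
apply: (@le_trans _ _ (K^-1 * K)); last by rewrite mulVf ?gt_eqF.
by rewrite /K mulrDr lerD2l.
Qed.

Definition log_norm (u : Rn R n -> R) Q : R := ln (fine (restr_norm u (cube_set Q))).

Definition log_norm1 Q : R := log_norm (fun=> 1%R) Q.

Lemma log_normE u Q : (0 < restr_norm u (cube_set Q) < +oo)%E ->
  restr_norm u (cube_set Q) = (expR (log_norm u Q))%:E.
Proof.
move=> /andP[h0 h1]; rewrite /log_norm lnK ?fineK// ?ge0_fin_numE ?ltW//.
by rewrite posrE fine_gt0// h0.
Qed.

Lemma log_norm1_bound : exists2 C, 0 < C & forall Q, 0 < cube_edge Q ->
  [/\ restr_norm (fun=> 1%R) (cube_set Q) = (expR (log_norm1 Q))%:E,
     `|log_norm1 Q - ln (vol Q) / r_ Q| <= C &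
     (\int[mu]_(x in cube_set Q) (osc Q x)%:E <= (C * vol Q)%:E)%E].
Proof.
have [C C_gt0 hC] := mean_log_osc_le.
have [k k0 hk] := pow_integral_one_le.
have C'0 : 0 <= pM * C / pm by nonneg.
exists (C + k + pM * C / pm + 1) => [|Q Q0]; first by lra.
have mQ := measurable_cube Q.
have v0 := vol_gt0 Q0.
set N := restr_norm _ _; set t := ln (vol Q) / r_ Q.
have N1 : (N <= (expR (t + k))%:E)%E.
  by apply: (restr_norm_le pE pm_gt0 q_ge one_ge0 (expR_gt0 _)); exact: hk.
have Nfin : (0 < N < +oo)%E.
  rewrite (le_lt_trans N1 (ltry _)) andbT.
  apply: (restr_norm_gt0 pE mq pm_gt0 q_ge mQ _ measurable_one one_ge0).
    by rewrite [X in (_ < X)%E](lebesgue_cube Q0) lte_fin.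
  by apply: aeW => x.
have NE := log_normE Nfin; split=> //.
- rewrite ler_norml; apply/andP; split.
    have : t - pM * C / pm <= log_norm1 Q + 1.
      apply: (pow_integral_one_ge Q0 (hC Q Q0)).
      apply: (lt_restr_norm pE mq pm_gt0 q_ge mQ measurable_one one_ge0).
      by rewrite NE lte_fin ltr_expR /log_norm1; lra.
    rewrite -/t; lra.
  have : log_norm1 Q <= t + k by rewrite -ler_expR -lee_fin -NE.
  rewrite -/t; lra.
- apply: le_trans (hC Q Q0) _; rewrite lee_fin ler_pM2r//; lra.
Qed.

End cube_norm.

(** * Scalar weights *)

Section scalar_weight.
Context {R : realType} {n : nat}.
Local Notation mu := (@lebesgueRn R n).
Variables (p : Rn R n -> \bar R) (q : Rn R n -> R) (pm pM rinf C : R).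
Hypothesis n_gt0 : (0 < n)%N.
Hypothesis pE : forall x, p x = (q x)%:E.
Hypothesis mq : measurable_fun setT q.
Hypothesis pm_gt0 : 0 < pm.
Hypothesis q_ge : forall x, pm <= q x.
Hypothesis q_le : forall x, q x <= pM.
Implicit Types (Q : cube R n).

Local Notation r_ := (ref_exponent q rinf).
Local Notation osc := (log_osc q rinf).
Local Notation restr_norm := (restr_norm p).
Local Notation pow_integral := (pow_integral q).
Local Notation log_norm := (log_norm p).
Local Notation log_norm1 := (log_norm1 p).

Hypothesis C_gt0 : 0 < C.
Hypothesis hC : forall Q, 0 < cube_edge Q ->
  [/\ restr_norm (fun=> 1%R) (cube_set Q) = (expR (log_norm1 Q))%:E,
     `|log_norm1 Q - ln (vol Q) / r_ Q| <= C &
     (\int[mu]_(x in cube_set Q) (osc Q x)%:E <= (C * vol Q)%:E)%E].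
Hypothesis hD : forall Q l, 0 < cube_edge Q -> 1 <= l ->
  log_norm1 (dilate l Q) - log_norm1 Q <= C + n%:R / pm * ln l.

Section one_weight.
Variable (u : Rn R n -> R).
Hypothesis mu_u : measurable_fun setT u.
Hypothesis u_ge0 : forall x, 0 <= u x.
Hypothesis u_gt0 : {ae mu, forall x, 0 < u x}.

(** This half of the oscillation bound holds for every weight.  With
    [y = vol Q * (u x / l) `^ q x], one has
    [ln (u x) - ln l = (ln y - ln (vol Q)) / q x] and [ln y <= y], while the
    mean of [y] is at most 1. *)
Lemma mean_pos_log_le Q l : 0 < cube_edge Q -> 0 < l ->
  (pow_integral u (cube_set Q) l <= 1)%E ->
  (\int[mu]_(x in cube_set Q)
    (Num.max 0 (ln (u x) - (ln l - log_norm1 Q)))%:E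
   <= ((pm^-1 + 2 * C) * vol Q)%:E)%E.
Proof.
move=> Q0 l0 h1; have v0 := vol_gt0 Q0; have mQ := measurable_cube Q.
have [_ tC oscC] := hC Q0.
have mp := measurable_pow_integrand (A := cube_set Q) mq l mu_u.
have p0 := @pow_integrand_ge0 _ _ q u (cube_set Q) l.
have mo : measurable_fun (cube_set Q) (fun x => (osc Q x)%:E).
  exact/measurable_EFinP/measurable_funTS/(measurable_log_osc rinf mq pm_gt0 q_ge).
have o0 x : cube_set Q x -> (0 <= (osc Q x)%:E)%E by rewrite lee_fin log_osc_ge0.
have c0 : 0 <= vol Q / pm by rewrite divr_ge0// ltW.
have c0' : (0 <= (vol Q / pm)%:E)%E by rewrite lee_fin.
have C0' : (0 <= C%:E)%E by rewrite lee_fin ltW.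
have mp' := measurable_funeM (vol Q / pm)%:E mp.
have mC : measurable_fun (cube_set Q) (fun=> C%:E) by exact: measurable_cst.
have mS := emeasurable_funD mC mo.
apply: (@le_trans _ _ (\int[mu]_(x in cube_set Q)
    ((vol Q / pm)%:E * ((u x / l) `^ q x)%:E + (C%:E + (osc Q x)%:E))%E)%E); last first.
  rewrite (ge0_integralD _ mQ _ mp' _ mS); last 2 first.
  - by move=> x Qx; rewrite mule_ge0// p0.
  - by move=> x Qx; rewrite adde_ge0// o0.
  rewrite (ge0_integralD _ mQ _ mC o0 mo)//.
  rewrite (ge0_integralZl _ mQ mp p0 c0') integral_cst//.
  rewrite [X in (_ + (_ * X + _) <= _)%E](lebesgue_cube Q0).
  rewrite mulrDl EFinD leeD//.
    by rewrite -[leRHS]mule1 [pm^-1 * _]mulrC lee_wpmul2l.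
  by rewrite mulr2n mulrDl mul1r mulrDl EFinD -EFinM leeD2l.
apply: (ae_ge0_le_integral mQ).
- by move=> x _; rewrite lee_fin le_max lexx.
- apply/measurable_EFinP/measurable_funTS; apply: measurable_maxr.
    exact: measurable_cst.
  apply: measurable_funB; last exact: measurable_cst.
  exact: (measurableT_comp (@measurable_ln R) mu_u).
- by move=> x Qx; rewrite !adde_ge0 ?mule_ge0// ?p0 ?o0.
- exact: emeasurable_funD.
apply: filterS u_gt0 => x ux Qx; rewrite -EFinM -!EFinD lee_fin.
have qx : 0 < q x := lt_le_trans pm_gt0 (q_ge x).
have w0 : 0 < (u x / l) `^ q x by rewrite powR_gt0// divr_gt0.
have os0 : 0 <= osc Q x by exact: log_osc_ge0.
rewrite ge_max; apply/andP; split.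
  by rewrite !addr_ge0 ?(ltW C_gt0)// mulr_ge0// ltW.
set y := vol Q * (u x / l) `^ q x.
have y0 : 0 < y by rewrite mulr_gt0.
have lny : ln y = ln (vol Q) + q x * (ln (u x) - ln l).
  by rewrite lnM ?posrE// ln_powR ln_div ?posrE.
have E : ln (u x) - ln l = ln y / q x - ln (vol Q) / q x.
  by rewrite lny; field; rewrite gt_eqF.
have h2 : ln y / q x <= y / pm.
  apply: (@le_trans _ _ (y / q x)).
    by rewrite ler_pM2r ?invr_gt0// ltW// ln_sublinear.
  by rewrite ler_pM2l// lef_pV2.
have h3 : ln (vol Q) / r_ Q - ln (vol Q) / q x <= osc Q x.
  rewrite -mulrBr /log_osc -normrM -normrN -mulrN opprB; exact: ler_norm.
have h4 := le_trans (ler_norm _) tC.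
have -> : vol Q / pm * (u x / l) `^ q x = y / pm by rewrite /y mulrAC.
lra.
Qed.

Variable kappa : R.
Hypothesis kappa_ge0 : 0 <= kappa.
Hypothesis u_fin : forall Q, 0 < cube_edge Q -> (restr_norm u (cube_set Q) < +oo)%E.
Hypothesis hkappa : forall Q, 0 < cube_edge Q ->
  (\int[mu]_(x in cube_set Q) (log_norm u Q - log_norm1 Q - ln (u x))%:E
   <= (kappa * vol Q)%:E)%E.

Definition log_ratio Q := log_norm u Q - log_norm1 Q.

Lemma restr_normE Q : 0 < cube_edge Q ->
  restr_norm u (cube_set Q) = (expR (log_norm u Q))%:E.
Proof.
move=> Q0; apply: log_normE; rewrite u_fin// andbT.
apply: (restr_norm_gt0 pE mq pm_gt0 q_ge (measurable_cube Q) _ mu_u u_ge0 u_gt0).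
by rewrite [X in (_ < X)%E](lebesgue_cube Q0) lte_fin vol_gt0.
Qed.

Definition osc_bound := kappa + 2 * (pm^-1 + 2 * C + ln 2).

Lemma osc_bound_gt0 : 0 < osc_bound.
Proof.
have : 0 < pm^-1 by rewrite invr_gt0.
have : 0 < ln 2 :> R by rewrite ln_gt0// ltr1n.
rewrite /osc_bound; have := kappa_ge0; have := C_gt0; lra.
Qed.

Lemma measurable_ln_u : measurable_fun setT (fun x => ln (u x)).
Proof. exact: (measurableT_comp (@measurable_ln R) mu_u). Qed.

(** The function [log_ratio Q - ln u] has mean at most [kappa] by hypothesis,
    and its negative part has bounded mean by [mean_pos_log_le]; together
    these bound the mean of its absolute value. *)
Lemma mean_osc_le Q : 0 < cube_edge Q ->
  (\int[mu]_(x in cube_set Q) `|ln (u x) - log_ratio Q|%:E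
   <= (osc_bound * vol Q)%:E)%E.
Proof.
move=> Q0; have v0 := vol_gt0 Q0; have mQ := measurable_cube Q.
have ln2 : 0 < ln 2 :> R by rewrite ln_gt0// ltr1n.
pose g x := log_ratio Q - ln (u x).
have mg : measurable_fun setT g.
  by apply: measurable_funB; [exact: measurable_cst|exact: measurable_ln_u].
have mG : measurable_fun (cube_set Q) (EFin \o g).
  exact/measurable_EFinP/measurable_funTS.
set X := (\int[mu]_(x in cube_set Q) ((EFin \o g)^\+ x))%E.
set Y := (\int[mu]_(x in cube_set Q) ((EFin \o g)^\- x))%E.
have Yle : (Y <= ((pm^-1 + 2 * C + ln 2) * vol Q)%:E)%E.
  (* The factor 2 puts [l] strictly above the norm, at the price of [ln 2]. *)
  pose l := expR (log_norm u Q + ln 2).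
  have hl : (pow_integral u (cube_set Q) l <= 1)%E.
    apply: (lt_restr_norm pE mq pm_gt0 q_ge mQ mu_u u_ge0).
    by rewrite restr_normE// lte_fin ltr_expR ltrDl.
  have := mean_pos_log_le Q0 (expR_gt0 _) hl; rewrite expRK => h.
  pose k x := Num.max 0 (ln (u x) - (log_norm u Q + ln 2 - log_norm1 Q)).
  have mk : measurable_fun (cube_set Q) (EFin \o k).
    apply/measurable_EFinP/measurable_funTS; apply: measurable_maxr.
      exact: measurable_cst.
    by apply: measurable_funB; [exact: measurable_ln_u|exact: measurable_cst].
  have k0 x : cube_set Q x -> (0 <= (k x)%:E)%E by rewrite lee_fin le_max lexx.
  have m2 : measurable_fun (cube_set Q) (fun=> (ln 2 : R)%:E) by exact: measurable_cst.
  have l20 x : cube_set Q x -> (0 <= (ln 2 : R)%:E)%E by rewrite lee_fin ltW.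
  apply: (@le_trans _ _ (\int[mu]_(x in cube_set Q) ((k x)%:E + (ln 2)%:E)%E)%E).
    apply: (ge0_le_integral _ mQ).
    - by move=> x _; exact: funeneg_ge0.
    - exact: measurable_funeneg.
    - exact: emeasurable_funD.
    - move=> x _; rewrite funenegE /= -EFinD ge_max !lee_fin /g /k /log_ratio.
      set c := ln (u x) - _.
      have c1 : c <= Num.max 0 c by rewrite le_max lexx orbT.
      have c0 : 0 <= Num.max 0 c by rewrite le_max lexx.
      by apply/andP; split; rewrite /c in c1 c0 *; lra.
  rewrite (ge0_integralD _ mQ k0 mk l20 m2) integral_cst//.
  by rewrite [X in (_ + _ * X <= _)%E](lebesgue_cube Q0) -EFinM [in leRHS]mulrDl EFinD leeD2r.
have Y0 : (0 <= Y)%E by apply: integral_ge0 => x _; exact: funeneg_ge0.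
have Yfin : Y \is a fin_num.
  by rewrite ge0_fin_numE// (le_lt_trans Yle (ltry _)).
have XY : (X - Y <= (kappa * vol Q)%:E)%E.
  by have := hkappa Q0; rewrite integralE.
have Xle : (X <= (kappa * vol Q)%:E + Y)%E by rewrite -leeBlDr.
have -> : (\int[mu]_(x in cube_set Q) `|ln (u x) - log_ratio Q|%:E = X + Y)%E.
  rewrite /X /Y -(ge0_integralD _ mQ); last 4 first.
  - by move=> x _; exact: funepos_ge0.
  - exact: measurable_funepos.
  - by move=> x _; exact: funeneg_ge0.
  - exact: measurable_funeneg.
  apply: eq_integral => x _.
  have -> : ((EFin \o g)^\+ x + (EFin \o g)^\- x = `|(EFin \o g) x|)%E.
    by rewrite -[RHS]/((abse \o (EFin \o g)) x) fune_abse.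
  by rewrite /= distrC.
apply: (@le_trans _ _ ((kappa * vol Q)%:E + Y + Y)%E); first by rewrite leeD2r.
rewrite -addeA; apply: (@le_trans _ _ ((kappa * vol Q)%:E +
  (((pm^-1 + 2 * C + ln 2) * vol Q)%:E + ((pm^-1 + 2 * C + ln 2) * vol Q)%:E))%E).
  by rewrite leeD2l// leeD.
by rewrite -!EFinD lee_fin /osc_bound; lra.
Qed.


Lemma log_norm_mono P Q : 0 < cube_edge P -> 0 < cube_edge Q ->
  cube_set P `<=` cube_set Q -> log_norm u P <= log_norm u Q.
Proof.
move=> P0 Q0 PQ.
suff h : (restr_norm u (cube_set P) <= restr_norm u (cube_set Q))%E.
  move: h; rewrite (restr_normE P0).
  rewrite (restr_normE Q0).
  rewrite lee_fin.
  by rewrite ler_expR.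
have := restr_norm_mono pE mq pm_gt0 q_ge (measurable_cube P) (measurable_cube Q)
  PQ mu_u mu_u u_ge0 u_ge0 ltr01.
rewrite mul1e; apply => x _.
by rewrite mul1r.
Qed.

Lemma log_norm1_mono P Q : 0 < cube_edge P -> 0 < cube_edge Q ->
  cube_set P `<=` cube_set Q -> log_norm1 P <= log_norm1 Q.
Proof.
move=> P0 Q0 PQ.
suff h : (restr_norm (fun=> 1%R) (cube_set P) <= restr_norm (fun=> 1%R) (cube_set Q))%E.
  have [eP _ _] := hC P0; have [eQ _ _] := hC Q0.
  by move: h; rewrite eP eQ lee_fin ler_expR.
have m1 : measurable_fun setT (fun _ : Rn R n => (1 : R)) by exact: measurable_cst.
have one_ge0 (x : Rn R n) : 0 <= (1 : R) by [].
have := restr_norm_mono pE mq pm_gt0 q_ge (measurable_cube P) (measurable_cube Q)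
  PQ m1 m1 one_ge0 one_ge0 ltr01.
rewrite mul1e; apply => x _.
by rewrite mul1r.
Qed.

(** A cube inside [3 Q], disjoint from [Q] whatever faces [Q] contains, and
    large enough for [12] times it to contain [3 Q]. *)
Definition side_cube Q : cube R n :=
  Cube (point_of (fun i => coordRn (cube_center Q) i +
    (if i == Ordinal n_gt0 then cube_edge Q else 0))) (cube_edge Q / 2)
    (fun=> true) (fun=> true).

Lemma side_cube_sub Q : 0 < cube_edge Q ->
  cube_set (side_cube Q) `<=` cube_set (dilate 3 Q).
Proof.
move=> Q0; apply: cube_subset => i; rewrite coord_point_of /= addrAC subrr add0r.
by case: ifP => _; rewrite ?normr0 ?ger0_norm ?(ltW Q0)//; lra.
Qed.

Lemma sub_side_cube Q : 0 < cube_edge Q ->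
  cube_set (dilate 3 Q) `<=` cube_set (dilate 12 (side_cube Q)).
Proof.
move=> Q0; apply: cube_subset => i; rewrite coord_point_of /= opprD addrA subrr add0r normrN.
by case: ifP => _; rewrite ?normr0 ?ger0_norm ?(ltW Q0)//; lra.
Qed.

Lemma side_cube_disj Q : 0 < cube_edge Q ->
  cube_set Q `&` cube_set (side_cube Q) = set0.
Proof.
move=> Q0; apply/seteqP; split => x //= [/(cube_coord_le (Ordinal n_gt0)) h1
  /(cube_coord_le (Ordinal n_gt0))].
by rewrite coord_point_of /= ?eqxx; move: h1; rewrite !ler_norml; lra.
Qed.

Definition side_loss := osc_bound * 6 ^+ n + osc_bound + C + n%:R / pm * ln 12.

Lemma side_loss_gt0 : 0 < side_loss.
Proof.
have ln12 : 0 <= ln 12 :> R by rewrite ln_ge0// ler1n.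
have b0 := osc_bound_gt0; have c0 := C_gt0.
have h : 0 <= n%:R / pm * ln 12 by nonneg.
have : 0 <= osc_bound * 6 ^+ n by nonneg.
rewrite /side_loss; lra.
Qed.

(** The oscillation bound compares the normalised norms of [3 Q] and of the
    side cube; the norms of their indicators are compared through the
    concentric dilate by [12], the only kind of pair that [hD] covers. *)
Lemma side_cube_log_norm Q : 0 < cube_edge Q ->
  log_norm u (dilate 3 Q) <= log_norm u (side_cube Q) + side_loss.
Proof.
move=> Q0.
have S0 : 0 < cube_edge (side_cube Q) by rewrite /= divr_gt0.
have Q30 : 0 < cube_edge (dilate 3 Q) by rewrite mulr_gt0.
have S120 : 0 < cube_edge (dilate 12 (side_cube Q)) by rewrite mulr_gt0.
have := abs_mean_subset_le measurable_ln_u mean_osc_le S0 Q30 (side_cube_sub Q0).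
have -> : vol (dilate 3 Q) / vol (side_cube Q) = 6 ^+ n.
  rewrite /vol /= -expr_div_n; congr (_ ^+ _).
  by field; rewrite gt_eqF.
move=> /(le_trans (ler_norm _)).
have := log_norm1_mono Q30 S120 (sub_side_cube Q0).
have := @hD (side_cube Q) 12 S0; rewrite ler1n => /(_ isT).
rewrite /log_ratio /side_loss.
move: (log_norm u (dilate 3 Q)) (log_norm u (side_cube Q)) (log_norm1 (dilate 3 Q))
  (log_norm1 (side_cube Q)) (log_norm1 (dilate 12 (side_cube Q))) => a b c d e.
by move: osc_bound (6 ^+ n) (n%:R / pm * ln 12) => B s t; lra.
Qed.

Definition side_share := expR (- ((side_loss + 2) * pM)).

Definition step_gain := - (ln (1 - side_share) / pM).

Let pM_gt0 : 0 < pM.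
Proof. exact: lt_le_trans pm_gt0 (le_trans (q_ge point) (q_le point)). Qed.

Lemma side_share_bounds : 0 < side_share < 1.
Proof.
rewrite expR_gt0/= expR_lt1 oppr_lt0 mulr_gt0//.
by have := side_loss_gt0; lra.
Qed.

Lemma step_gain_gt0 : 0 < step_gain.
Proof.
have /andP[s0 s1] := side_share_bounds.
rewrite /step_gain -mulNr divr_gt0// oppr_gt0 ln_lt0//; lra.
Qed.

(** The side cube carries at least the share [side_share] of the integral over
    [3 Q], by [side_cube_log_norm].  The remaining [1 - side_share] for [Q] is
    turned into a smaller norm by the boundedness of the exponent. *)
Lemma log_norm_step Q : 0 < cube_edge Q ->
  log_norm u Q <= log_norm u (dilate 3 Q) - step_gain.
Proof.
move=> Q0; have /andP[s0 s1] := side_share_bounds.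
have S0 : 0 < cube_edge (side_cube Q) by rewrite /= divr_gt0.
have Q30 : 0 < cube_edge (dilate 3 Q) by rewrite mulr_gt0.
have mQ := measurable_cube Q; have mS := measurable_cube (side_cube Q).
have mQ3 := measurable_cube (dilate 3 Q).
have d0 := side_loss_gt0.
apply/ler_addgt0Pr => e e0.
(* A level [expR s] slightly above the norm over [3 Q]; keeping [e <= 1]
   leaves it below [expR (2 + side_loss)] times the norm over the side cube. *)
wlog e1 : e e0 / e <= 1.
  move=> H; have [e1|e1] := leP e 1; first exact: H.
  by apply: le_trans (H 1 ltr01 (lexx _)) _; rewrite lerD2l ltW.
pose s := log_norm u (dilate 3 Q) + e.
pose P A := pow_integral u A (expR s).
have P3 : (P (cube_set (dilate 3 Q)) <= 1)%E.
  apply: (lt_restr_norm pE mq pm_gt0 q_ge mQ3 mu_u u_ge0).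
  by rewrite restr_normE// lte_fin ltr_expR ltrDl.
pose c := expR (- (side_loss + 2)).
have c01 : 0 < c <= 1 by rewrite expR_gt0/= expR_le1 oppr_le0; lra.
have PS : (side_share%:E <= P (cube_set (side_cube Q)))%E.
  rewrite leNgt; apply/negP => PS.
  have h : (pow_integral u (cube_set (side_cube Q)) (c * expR s) <= 1)%E.
    apply: le_trans (pow_integral_scale mq q_le mS mu_u u_ge0 (expR_gt0 s) c01) _.
    apply: le_trans (lee_wpmul2l _ (ltW PS)) _; first by rewrite lee_fin powR_ge0.
    by rewrite -EFinM lee_fin /c /side_share -expRM -expRD mulrNN subrr expR0.
  have : (restr_norm u (cube_set (side_cube Q)) <= (c * expR s)%:E)%E.
    apply: (restr_norm_le pE pm_gt0 q_ge u_ge0 _ h).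
    by rewrite mulr_gt0// expR_gt0.
  rewrite restr_normE// lee_fin /c -expRD ler_expR /s.
  have := side_cube_log_norm Q0.
  move: (log_norm u (dilate 3 Q)) (log_norm u (side_cube Q)) side_loss => a b d.
  lra.
have mp A : measurable_fun A (fun x => ((u x / expR s) `^ q x)%:E).
  exact: measurable_pow_integrand.
have PD : (P (cube_set Q) + P (cube_set (side_cube Q)) <= 1)%E.
  apply: le_trans P3; rewrite /P /pow_integral.
  rewrite -(ge0_integral_setU _ mQ mS (mp _)); last 2 first.
  - by move=> x _; rewrite lee_fin powR_ge0.
  - by apply/disj_set2P; exact: side_cube_disj.
  apply: (ge0_subset_integral _ _ mQ3 (mp _)) => //.
  - exact: measurableU.
  - by move=> x _; rewrite lee_fin powR_ge0.
  - move=> x [Qx|Sx]; last exact: side_cube_sub.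
    by move: Qx; apply: sub_dilate => //; rewrite ler1n.
have PQ : (P (cube_set Q) <= (1 - side_share)%:E)%E.
  rewrite EFinB leeBrDr//; apply: le_trans PD; exact: leeD2l.
have t1 : 0 < 1 - side_share by lra.
pose th := expR (- step_gain).
have th01 : 0 < th <= 1.
  by rewrite expR_gt0/= expR_le1 oppr_le0 ltW// step_gain_gt0.
have h : (pow_integral u (cube_set Q) (th * expR s) <= 1)%E.
  apply: le_trans (pow_integral_scale mq q_le mQ mu_u u_ge0 (expR_gt0 s) th01) _.
  apply: le_trans (lee_wpmul2l _ PQ) _; first by rewrite lee_fin powR_ge0.
  rewrite -EFinM lee_fin /th /step_gain -expRM opprK mulrN divfK ?gt_eqF//.
  by rewrite expRN lnK// mulVf ?gt_eqF.
have : (restr_norm u (cube_set Q) <= (th * expR s)%:E)%E.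
  apply: (restr_norm_le pE pm_gt0 q_ge u_ge0 _ h).
  by rewrite mulr_gt0// expR_gt0.
rewrite restr_normE// lee_fin /th -expRD ler_expR /s.
move: (log_norm u Q) (log_norm u (dilate 3 Q)) step_gain => a b d.
lra.
Qed.

(** The gain for norms over triples, against the growth of the norm of the
    indicator: the exponent of [l] is strictly below [n / pm]. *)
Lemma log_ratio_le_dilate Q l : 0 < cube_edge Q -> 1 <= l ->
  log_ratio Q <= log_ratio (dilate l Q) + (C + step_gain)
    + (n%:R / pm - step_gain / ln 3) * ln l.
Proof.
move=> Q0 l1; have lQ0 : 0 < cube_edge (dilate l Q) by rewrite mulr_gt0//; lra.
have := @gain_dilate R n (log_norm u) step_gain (ltW step_gain_gt0) _ log_norm_step Q l Q0 l1.
have mono Q' (a b : R) : 0 < cube_edge Q' -> 0 < a -> a <= b ->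
    log_norm u (dilate a Q') <= log_norm u (dilate b Q').
  move=> Q'0 a0 ab; have b0 : 0 < b by lra.
  by apply: log_norm_mono; [exact: mulr_gt0|exact: mulr_gt0|exact: dilate_subset].
move=> /(_ mono); have := hD Q0 l1; rewrite /log_ratio.
move: (ln l) (log_norm u (dilate l Q)) (log_norm u Q) (log_norm1 (dilate l Q))
  (log_norm1 Q) step_gain (n%:R / pm) => L a b c d e f.
rewrite mulrBl mulrBr mulr1 mulrA [e / _ * L]mulrAC; lra.
Qed.

Lemma log_ratio_dilate_le Q l : 0 < cube_edge Q -> 1 <= l ->
  log_ratio (dilate l Q) <= log_ratio Q + osc_bound * (2 ^+ n + 1)
    + osc_bound * (2 ^+ n + 1) / ln 2 * ln l.
Proof.
move=> Q0 l1.
have := abs_mean_dilate_le measurable_ln_u osc_bound_gt0 mean_osc_le Q0 l1.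
move=> /(le_trans (ler_norm _)).
move: (ln l) (log_ratio (dilate l Q)) (log_ratio Q) (osc_bound * (2 ^+ n + 1)) => L a b c.
rewrite mulrDr mulr1 [L / _]mulrC mulrA; lra.
Qed.

End one_weight.

End scalar_weight.

(** * The operator norm of complex matrices *)

(** Summing [2 a b <= (t / s) a ^ 2 + (s / t) b ^ 2] with [s] and [t] the two
    norms. *)
Lemma cauchy_schwarz_sum (R : realType) (I : finType) (a b : I -> R) :
  \sum_i a i * b i <= sqrtr (\sum_i a i ^+ 2) * sqrtr (\sum_i b i ^+ 2).
Proof.
set A := \sum_i a i ^+ 2; set B := \sum_i b i ^+ 2.
have A0 : 0 <= A by apply: sumr_ge0 => i _; exact: sqr_ge0.
have B0 : 0 <= B by apply: sumr_ge0 => i _; exact: sqr_ge0.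
have zero (c : I -> R) : \sum_i c i ^+ 2 <= 0 -> forall i, c i = 0.
  move=> h i; apply/eqP; rewrite -sqrf_eq0; apply/eqP.
  apply: (@psumr_eq0P R I (fun=> true) (fun j => c j ^+ 2)) => // [j _|].
    exact: sqr_ge0.
  by apply/eqP; rewrite eq_le h sumr_ge0// => j _; exact: sqr_ge0.
have rhs0 : 0 <= sqrtr A * sqrtr B by rewrite mulr_ge0// sqrtr_ge0.
have [hA|hA] := leP A 0.
  by rewrite big1// => i _; rewrite (zero a)// mul0r.
have [hB|hB] := leP B 0.
  by rewrite big1// => i _; rewrite (zero b)// mulr0.
set s := sqrtr A in rhs0 *; set t := sqrtr B in rhs0 *.
have s0 : 0 < s by rewrite sqrtr_gt0.
have t0 : 0 < t by rewrite sqrtr_gt0.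
have sE : s ^+ 2 = A by rewrite sqr_sqrtr// ltW.
have tE : t ^+ 2 = B by rewrite sqr_sqrtr// ltW.
have h i : a i * b i <= (t / s * a i ^+ 2 + s / t * b i ^+ 2) / 2.
  have := sqr_ge0 (t * a i - s * b i) => h.
  have st : 0 < s * t by exact: mulr_gt0.
  rewrite -(ler_pM2l st).
  rewrite (_ : s * t * ((t / s * a i ^+ 2 + s / t * b i ^+ 2) / 2) =
    (t ^+ 2 * a i ^+ 2 + s ^+ 2 * b i ^+ 2) / 2); last by field; rewrite !gt_eqF.
  by move: h; rewrite sqrrB; nra.
apply: le_trans (ler_sum _ (fun i _ => h i)) _.
rewrite -mulr_suml big_split /= -!mulr_sumr -/A -/B -sE -tE.
rewrite le_eqVlt; apply/orP; left; apply/eqP; field; rewrite !gt_eqF//.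
Qed.

Section operator_norm.
Local Open Scope complex_scope.
Context {R : realType} {m : nat}.
Implicit Types (A B : 'M[R[i]]_m) (z w : 'cV[R[i]]_m).

Lemma normc_ge0 (x : R[i]) : 0 <= normc x.
Proof. by case: x => a b; exact: sqrtr_ge0. Qed.

Lemma sqr_normc_Re_Im (x : R[i]) : normc x ^+ 2 = complex.Re x ^+ 2 + complex.Im x ^+ 2.
Proof. by case: x => a b; rewrite /= sqr_sqrtr// addr_ge0// sqr_ge0. Qed.

Lemma normc_le_sum (x : R[i]) : normc x <= `|complex.Re x| + `|complex.Im x|.
Proof.
rewrite -[leRHS]ger0_norm ?addr_ge0// -sqrtr_sqr -[leLHS]ger0_norm ?normc_ge0// -sqrtr_sqr.
rewrite ler_sqrt ?sqr_ge0// sqr_normc_Re_Im sqrrD !real_normK ?num_real//.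
have : 0 <= `|complex.Re x| * `|complex.Im x| by rewrite mulr_ge0.
by rewrite mulr2n; lra.
Qed.

Lemma normc_sum (I : finType) (f : I -> R[i]) :
  normc (\sum_i f i) <= \sum_i normc (f i).
Proof.
elim/big_ind2 : _ => //; first by rewrite normc0.
by move=> a x b y ax by_; apply: le_trans (le_normcD _ _) _; exact: lerD.
Qed.

Lemma cvnorm_ge0 z : 0 <= cvnorm z.
Proof. exact: sqrtr_ge0. Qed.

Lemma sqr_cvnorm z : cvnorm z ^+ 2 = \sum_(i < m) normc (z i 0) ^+ 2.
Proof. by rewrite sqr_sqrtr// sumr_ge0// => i _; exact: sqr_ge0. Qed.

Lemma normc_le_cvnorm z i : normc (z i 0) <= cvnorm z.
Proof.
rewrite -[leLHS]ger0_norm ?normc_ge0// -sqrtr_sqr ler_sqrt; last first.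
  by rewrite sumr_ge0// => j _; exact: sqr_ge0.
by rewrite (bigD1 i)//= lerDl sumr_ge0// => j _; exact: sqr_ge0.
Qed.

Lemma cvnorm_le_sum z : cvnorm z <= \sum_(i < m) normc (z i 0).
Proof.
rewrite -[leRHS]ger0_norm; last by rewrite sumr_ge0// => i _; exact: normc_ge0.
rewrite -sqrtr_sqr ler_sqrt ?sqr_ge0// expr2 big_distrlr /=.
apply: ler_sum => i _; rewrite (bigD1 i)//= expr2 lerDl sumr_ge0// => j _.
by rewrite mulr_ge0 ?normc_ge0.
Qed.

Lemma cvnorm_eq0 z : cvnorm z = 0 -> z = 0.
Proof.
move=> z0; apply/colP => i; rewrite mxE; apply: eq0_normc.
by apply/eqP; rewrite eq_le normc_ge0 andbT -z0 normc_le_cvnorm.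
Qed.

Lemma cvnormZ (c : R[i]) z : cvnorm (c *: z) = normc c * cvnorm z.
Proof.
rewrite /cvnorm (eq_bigr (fun i => normc c ^+ 2 * normc (z i 0) ^+ 2)); last first.
  by move=> i _; rewrite mxE normcM exprMn.
by rewrite -mulr_sumr sqrtrM ?sqr_ge0// sqrtr_sqr ger0_norm// normc_ge0.
Qed.

Lemma cvnormN z : cvnorm (- z) = cvnorm z.
Proof. by rewrite -scaleN1r cvnormZ normcN normc1 mul1r. Qed.

Lemma cvnormD z w : cvnorm (z + w) <= cvnorm z + cvnorm w.
Proof.
rewrite -[leRHS]ger0_norm ?addr_ge0 ?cvnorm_ge0// -sqrtr_sqr -[leLHS]ger0_norm ?cvnorm_ge0//.
rewrite -sqrtr_sqr ler_sqrt ?sqr_ge0// sqrrD !sqr_cvnorm.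
have := cauchy_schwarz_sum (fun i => normc (z i 0)) (fun i => normc (w i 0)).
rewrite -/(cvnorm z) -/(cvnorm w) => cs.
apply: (@le_trans _ _ (\sum_(i < m) (normc (z i 0) + normc (w i 0)) ^+ 2)).
  apply: ler_sum => i _; rewrite lerXn2r ?nnegrE ?normc_ge0 ?addr_ge0 ?normc_ge0//.
  by rewrite mxE le_normcD.
rewrite (eq_bigr (fun i => normc (z i 0) ^+ 2 + (normc (z i 0) * normc (w i 0)) *+ 2
   + normc (w i 0) ^+ 2)); last by move=> i _; rewrite sqrrD.
by rewrite big_split /= big_split /= lerD2r lerD2l sumrMnl lerMn2r.
Qed.

Definition entry_sum A : R := \sum_(i < m) \sum_(j < m) normc (A i j).

Lemma entry_sum_ge0 A : 0 <= entry_sum A.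
Proof. by rewrite !sumr_ge0// => i _; rewrite sumr_ge0// => j _; exact: normc_ge0. Qed.

(** Gives the supremum that defines the operator norm a finite upper
    bound. *)
Lemma cvnorm_mulmx_entry A z : cvnorm (A *m z) <= entry_sum A * cvnorm z.
Proof.
apply: le_trans (cvnorm_le_sum _) _; rewrite mulr_suml; apply: ler_sum => i _.
rewrite mxE; apply: le_trans (normc_sum _) _; rewrite mulr_suml; apply: ler_sum => j _.
by rewrite normcM ler_wpM2l ?normc_ge0// normc_le_cvnorm.
Qed.

Hypothesis m_gt0 : (0 < m)%N.

Lemma exists_unit_vector : exists z : 'cV[R[i]]_m, cvnorm z = 1.
Proof.
exists (\col_i (i == Ordinal m_gt0)%:R); rewrite /cvnorm (bigD1 (Ordinal m_gt0))//= big1.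
  by rewrite mxE eqxx addr0 normc1 expr1n sqrtr1.
by move=> i /negbTE h; rewrite mxE h normc0 expr0n.
Qed.

Let ubound A : ubound [set cvnorm (A *m z) | z in [set z | cvnorm z = 1]] (entry_sum A).
Proof. by move=> _ [z /= z1 <-]; rewrite -[leRHS]mulr1 -z1 cvnorm_mulmx_entry. Qed.

Lemma opnorm_has_sup A :
  has_sup [set cvnorm (A *m z) | z in [set z | cvnorm z = 1]].
Proof.
split; last by exists (entry_sum A); exact: ubound.
by have [z z1] := exists_unit_vector; exists (cvnorm (A *m z)); exists z.
Qed.

Lemma normc_real (a : R) : 0 <= a -> normc a%:C = a.
Proof. by move=> a0; rewrite /= expr0n /= addr0 sqrtr_sqr ger0_norm. Qed.

Lemma cvnorm_mulmx_le A z : cvnorm (A *m z) <= opnorm A * cvnorm z.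
Proof.
have [z0|z0] := eqVneq (cvnorm z) 0.
  have z0' := cvnorm_eq0 z0.
  by rewrite z0 mulr0 z0' mulmx0 -z0' z0.
have zp : 0 < cvnorm z by rewrite lt_neqAle eq_sym z0 cvnorm_ge0.
rewrite -ler_pdivrMr// mulrC.
have c0 : 0 <= (cvnorm z)^-1 by rewrite invr_ge0 ltW.
rewrite -{1}(normc_real c0) -cvnormZ scalemxAr.
apply: ub_le_sup; first by exists (entry_sum A); exact: ubound.
by exists ((cvnorm z)^-1%:C *: z) => //=; rewrite cvnormZ normc_real// mulVf.
Qed.

Lemma opnorm_le A t : (forall z, cvnorm (A *m z) <= t * cvnorm z) -> opnorm A <= t.
Proof.
move=> h; apply: ge_sup; first by case: (opnorm_has_sup A).
by move=> _ [z /= z1 <-]; rewrite -[leRHS]mulr1 -z1.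
Qed.

Lemma opnorm_ge0 A : 0 <= opnorm A.
Proof.
have [z z1] := exists_unit_vector.
have := cvnorm_mulmx_le A z; rewrite z1 mulr1; exact: le_trans (cvnorm_ge0 _).
Qed.

Lemma opnormM A B : opnorm (A *m B) <= opnorm A * opnorm B.
Proof.
apply: opnorm_le => z; rewrite -mulmxA; apply: le_trans (cvnorm_mulmx_le _ _) _.
by rewrite -mulrA ler_wpM2l ?opnorm_ge0// cvnorm_mulmx_le.
Qed.

Lemma opnorm_gt0 A : A \in unitmx -> 0 < opnorm A.
Proof.
move=> uA; rewrite lt_neqAle opnorm_ge0 andbT eq_sym; apply/eqP => A0.
have [z z1] := exists_unit_vector.
have := cvnorm_mulmx_le A (invmx A *m z); rewrite mulmxA mulmxV// mul1mx z1 A0 mul0r.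
by rewrite leNgt ltr01.
Qed.

Definition rat_vector (w : 'cV[rat * rat]_m) : 'cV[R[i]]_m :=
  \col_i Complex (ratr (w i 0).1) (ratr (w i 0).2).

Lemma exists_rat_vector z (e : R) : 0 < e ->
  exists w : 'cV[rat * rat]_m, cvnorm (z - rat_vector w) <= e.
Proof.
move=> e0; pose d := e / (2 * m%:R).
have mR : 0 < m%:R :> R by rewrite ltr0n.
have d0 : 0 < d by rewrite divr_gt0// mulr_gt0.
have approx (x : R) : exists r : rat, `|x - ratr r| <= d.
  have [r] := @rat_in_itvoo R (x - d) (x + d) ltac:(lra).
  by rewrite in_itv /= => /andP[? ?]; exists r; rewrite ler_norml; lra.
have [f hf] := choice approx.
exists (\col_i (f (complex.Re (z i 0)), f (complex.Im (z i 0)))).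
apply: le_trans (cvnorm_le_sum _) _.
apply: (@le_trans _ _ (\sum_(i < m) (2 * d))).
  apply: ler_sum => i _; rewrite !mxE /=; apply: le_trans (normc_le_sum _) _.
  have := hf (complex.Re (z i 0)); have := hf (complex.Im (z i 0)).
  by case: (z i 0) => a b /=; lra.
rewrite sumr_const card_ord -[leLHS]mulr_natl /d.
by rewrite le_eqVlt; apply/orP; left; apply/eqP; field; rewrite gt_eqF.
Qed.

(** The supremum over the sphere is replaced by countably many conditions, so
    that the operator norm of a measurable matrix function is measurable. *)
Lemma opnorm_le_rat A (t : R) : 0 <= t ->
  (opnorm A <= t <-> forall w : 'cV[rat * rat]_m, cvnorm (A *m rat_vector w) <= t * cvnorm (rat_vector w)).
Proof.
move=> t0; split=> [h w|h].
  by apply: le_trans (cvnorm_mulmx_le _ _) _; rewrite ler_wpM2r ?cvnorm_ge0.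
apply: opnorm_le => z; apply/ler_addgt0Pr => e e0.
set K := entry_sum A; have K0 : 0 <= K := entry_sum_ge0 A.
have e'0 : 0 < e / (K + t + 1) by rewrite divr_gt0//; lra.
have [w hw] := exists_rat_vector z e'0.
set v := rat_vector w in hw.
have h1 : cvnorm (A *m z) <= cvnorm (A *m v) + K * cvnorm (z - v).
  have -> : A *m z = A *m v + A *m (z - v) by rewrite -mulmxDr addrC subrK.
  exact: le_trans (cvnormD _ _) (lerD (lexx _) (cvnorm_mulmx_entry _ _)).
have h2 : cvnorm v <= cvnorm z + cvnorm (z - v).
  have ve : v = z + - (z - v) by rewrite opprB addrC subrK.
  by rewrite -(cvnormN (z - v)) [leLHS](congr1 cvnorm ve); exact: cvnormD.
have h3 := h w; rewrite -/v in h3.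
have h4 : (K + t) * cvnorm (z - v) <= e.
  apply: (@le_trans _ _ ((K + t) * (e / (K + t + 1)))).
    by rewrite ler_wpM2l// addr_ge0.
  rewrite mulrCA ler_piMr ?(ltW e0)// ler_pdivrMr; lra.
have h5 := ler_wpM2l t0 h2.
move: h1 h3 h4 h5; rewrite mulrDl mulrDr.
move: (cvnorm _) (cvnorm _) (cvnorm _) (cvnorm _) => *; lra.
Qed.

End operator_norm.

(** * Measurability of matrix-valued functions and of the normalised norm *)

Section measurable_complex.
Local Open Scope complex_scope.
Context d (T : measurableType d) {R : realType}.
Implicit Types (f g : T -> R[i]).

(** Measurability of the real and imaginary parts, which is how complex
    integrability is expressed for matrix weights. *)
Definition cmeasurable f := measurable_fun setT (fun x => complex.Re (f x)) /\
  measurable_fun setT (fun x => complex.Im (f x)).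

Lemma cmeasurable_cst (c : R[i]) : cmeasurable (fun=> c).
Proof. by split; exact: measurable_cst. Qed.

Lemma cmeasurableD f g : cmeasurable f -> cmeasurable g ->
  cmeasurable (fun x => f x + g x).
Proof.
move=> [f1 f2] [g1 g2]; split.
  rewrite (_ : (fun x => _) = (fun x => complex.Re (f x) + complex.Re (g x))).
    exact: measurable_funD.
  by apply/funext => x; case: (f x) (g x) => ? ? [].
rewrite (_ : (fun x => _) = (fun x => complex.Im (f x) + complex.Im (g x))).
  exact: measurable_funD.
by apply/funext => x; case: (f x) (g x) => ? ? [].
Qed.

Lemma cmeasurableM f g : cmeasurable f -> cmeasurable g ->
  cmeasurable (fun x => f x * g x).
Proof.
move=> [f1 f2] [g1 g2]; split.
  rewrite (_ : (fun x => _) = (fun x => complex.Re (f x) * complex.Re (g x)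
      - complex.Im (f x) * complex.Im (g x))).
    by apply: measurable_funB; exact: measurable_funM.
  by apply/funext => x; case: (f x) (g x) => ? ? [].
rewrite (_ : (fun x => _) = (fun x => complex.Re (f x) * complex.Im (g x)
    + complex.Im (f x) * complex.Re (g x))).
  by apply: measurable_funD; exact: measurable_funM.
by apply/funext => x; case: (f x) (g x) => ? ? [].
Qed.

Lemma cmeasurable_sum (I : Type) (s : seq I) (P : pred I) (h : I -> T -> R[i]) :
  (forall i, cmeasurable (h i)) -> cmeasurable (fun x => \sum_(i <- s | P i) h i x).
Proof.
move=> mh; elim: s => [|i s ih].
  by under eq_fun do rewrite big_nil; exact: cmeasurable_cst.
under eq_fun do rewrite big_cons; case: (P i) => //; exact: cmeasurableD.
Qed.

Lemma cmeasurable_prod (I : Type) (s : seq I) (P : pred I) (h : I -> T -> R[i]) :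
  (forall i, cmeasurable (h i)) -> cmeasurable (fun x => \prod_(i <- s | P i) h i x).
Proof.
move=> mh; elim: s => [|i s ih].
  by under eq_fun do rewrite big_nil; exact: cmeasurable_cst.
under eq_fun do rewrite big_cons; case: (P i) => //; exact: cmeasurableM.
Qed.

Let measurable_invr (f : T -> R) : measurable_fun setT f ->
  (forall x, 0 <= f x) -> measurable_fun setT (fun x => (f x)^-1).
Proof.
move=> mf f0; rewrite (_ : (fun x => _) = (fun x => f x `^ (-1))).
  exact: (measurableT_comp (measurable_powR (-1)) mf).
by apply/funext => x; rewrite powR_inv1.
Qed.

Lemma cmeasurableV f : cmeasurable f -> cmeasurable (fun x => (f x)^-1).
Proof.
move=> [f1 f2].
pose n2 x := complex.Re (f x) ^+ 2 + complex.Im (f x) ^+ 2.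
have mn : measurable_fun setT (fun x => (n2 x)^-1).
  apply: measurable_invr; last by move=> x; rewrite addr_ge0// sqr_ge0.
  by apply: measurable_funD; exact: measurable_funX.
split.
  rewrite (_ : (fun x => _) = (fun x => complex.Re (f x) * (n2 x)^-1)).
    exact: measurable_funM.
  by apply/funext => x; rewrite /n2; case: (f x).
rewrite (_ : (fun x => _) = (fun x => - (complex.Im (f x) * (n2 x)^-1))).
  by apply: measurableT_comp; [exact: oppr_measurable|exact: measurable_funM].
by apply/funext => x; rewrite /n2; case: (f x).
Qed.

Lemma measurable_neq0 f : cmeasurable f -> measurable_fun setT (fun x => f x != 0).
Proof.
move=> [f1 f2].
rewrite (_ : (fun x => _) = (fun x => ~~ ((complex.Re (f x) == 0) && (complex.Im (f x) == 0)))).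
  apply: measurable_neg; apply: measurable_and.
    by apply: measurable_fun_eqr => //; exact: measurable_cst.
  by apply: measurable_fun_eqr => //; exact: measurable_cst.
by apply/funext => x; case: (f x) => a b; rewrite eq_complex.
Qed.

Lemma measurable_normc f : cmeasurable f -> measurable_fun setT (fun x => normc (f x)).
Proof.
move=> [f1 f2].
rewrite (_ : (fun x => _) = (fun x => sqrtr (complex.Re (f x) ^+ 2 + complex.Im (f x) ^+ 2))).
  apply: measurableT_comp.
    by apply: continuous_measurable_fun; exact: sqrt_continuous.
  by apply: measurable_funD; exact: measurable_funX.
by apply/funext => x; case: (f x).
Qed.

Definition mxmeasurable k l (M : T -> 'M[R[i]]_(k, l)) := forall i j, cmeasurable (fun x => M x i j).

Lemma mxmeasurableM k l r (M : T -> 'M[R[i]]_(k, l)) (N : T -> 'M[R[i]]_(l, r)) :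
  mxmeasurable M -> mxmeasurable N -> mxmeasurable (fun x => M x *m N x).
Proof.
move=> mM mN i j; rewrite (_ : (fun x => _) = (fun x => \sum_k M x i k * N x k j)).
  by apply: cmeasurable_sum => k'; exact: cmeasurableM.
by apply/funext => x; rewrite mxE.
Qed.

Lemma mxmeasurable_cst k l (M : 'M[R[i]]_(k, l)) : mxmeasurable (fun=> M).
Proof. by move=> i j; exact: cmeasurable_cst. Qed.

Lemma cmeasurable_det k (M : T -> 'M[R[i]]_k) : mxmeasurable M ->
  cmeasurable (fun x => \det (M x)).
Proof.
move=> mM; rewrite /determinant; apply: cmeasurable_sum => s.
apply: cmeasurableM; first exact: cmeasurable_cst.
by apply: cmeasurable_prod => i; exact: mM.
Qed.

Lemma mxmeasurable_adj k (M : T -> 'M[R[i]]_k) : mxmeasurable M ->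
  mxmeasurable (fun x => \adj (M x)).
Proof.
move=> mM i j; rewrite (_ : (fun x => _) = (fun x => cofactor (M x) j i)).
  rewrite /cofactor; apply: cmeasurableM; first exact: cmeasurable_cst.
  apply: cmeasurable_det => a b.
  by under eq_fun do rewrite !mxE; exact: mM.
by apply/funext => x; rewrite mxE.
Qed.

Lemma mxmeasurable_inv k (M : T -> 'M[R[i]]_k) : mxmeasurable M ->
  mxmeasurable (fun x => invmx (M x)).
Proof.
move=> mM i j.
have mu : measurable_fun setT (fun x => \det (M x) != 0).
  by apply: measurable_neq0; exact: cmeasurable_det.
have E x : invmx (M x) i j =
    if \det (M x) != 0 then (\det (M x))^-1 * \adj (M x) i j else M x i j.
  by rewrite /invmx unitmxE unitfE; case: ifP => // _; rewrite mxE.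
have [m1 m2] : cmeasurable (fun x => (\det (M x))^-1 * \adj (M x) i j).
  by apply: cmeasurableM; [exact/cmeasurableV/cmeasurable_det|exact: mxmeasurable_adj].
have [n1 n2] := mM i j.
split.
  rewrite (_ : (fun x => _) = (fun x => if \det (M x) != 0
    then complex.Re ((\det (M x))^-1 * \adj (M x) i j) else complex.Re (M x i j))).
    exact: measurable_fun_ifT.
  by apply/funext => x; rewrite E; case: ifP.
rewrite (_ : (fun x => _) = (fun x => if \det (M x) != 0
  then complex.Im ((\det (M x))^-1 * \adj (M x) i j) else complex.Im (M x i j))).
  exact: measurable_fun_ifT.
by apply/funext => x; rewrite E; case: ifP.
Qed.

Lemma measurable_cvnorm k (z : T -> 'cV[R[i]]_k) : mxmeasurable z ->
  measurable_fun setT (fun x => cvnorm (z x)).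
Proof.
move=> mz; apply: measurableT_comp.
  by apply: continuous_measurable_fun; exact: sqrt_continuous.
by apply: measurable_sum => i; apply: measurable_funX; exact: measurable_normc.
Qed.

Lemma measurable_fun_le (f : T -> R) :
  (forall t, measurable [set x | f x <= t]) -> measurable_fun setT f.
Proof.
move=> h; apply: (measurability _ (RGenOInfty.measurableE R)).
move=> _ [_ [t ->] <-]; rewrite setTI.
rewrite (_ : _ @^-1` _ = ~` [set x | f x <= t]); first exact: measurableC.
by apply/seteqP; split => x /=; rewrite in_itv/= andbT ltNge => /negP.
Qed.

Lemma measurable_opnorm k (M : T -> 'M[R[i]]_k) : (0 < k)%N -> mxmeasurable M ->
  measurable_fun setT (fun x => opnorm (M x)).
Proof.
move=> k0 mM; apply: measurable_fun_le => t.
have [t0|t0] := ltP t 0.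
  rewrite (_ : mkset _ = set0) //; apply/seteqP; split => x //= h.
  by have := opnorm_ge0 k0 (M x); rewrite leNgt (le_lt_trans h t0).
pose S (w : 'cV[rat * rat]_k) := [set x | cvnorm (M x *m rat_vector w) <= t * cvnorm (rat_vector w : 'cV[R[i]]_k)].
have mS w : measurable (S w).
  have mc : measurable_fun setT (fun x => cvnorm (M x *m rat_vector w)).
    by apply: measurable_cvnorm; apply: mxmeasurableM => //; exact: mxmeasurable_cst.
  rewrite (_ : S w = setT `&` (fun x => cvnorm (M x *m rat_vector w)) @^-1`
    `]-oo, t * cvnorm (rat_vector w : 'cV[R[i]]_k)]).
    by apply: mc.
  by rewrite setTI; apply/seteqP; split => x; rewrite /= in_itv.
rewrite (_ : mkset _ = \bigcap_i (if unpickle i is Some w then S w else setT)).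
  by apply: bigcap_measurableType => i _; case: (unpickle i).
apply/seteqP; split => x /=.
  by move=> /(opnorm_le_rat k0 _ t0) h i _; case: (unpickle i) => //= w; exact: h.
move=> h; apply/(opnorm_le_rat k0 _ t0) => w.
by have := h (pickle w) I; rewrite pickleK.
Qed.

End measurable_complex.

Section weight_measurability.
Local Open Scope complex_scope.
Context {R : realType} {m n : nat}.
Local Notation mu := (@lebesgueRn R n).
Variables (p : Rn R n -> \bar R) (q : Rn R n -> R) (pm : R).
Hypothesis pE : forall x, p x = (q x)%:E.
Hypothesis mq : measurable_fun setT q.
Hypothesis pm_gt0 : 0 < pm.
Hypothesis q_ge : forall x, pm <= q x.
Variable W : Rn R n -> 'M[R[i]]_m.
Hypothesis m_gt0 : (0 < m)%N.
Hypothesis WW : matrix_weight W.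

Lemma mxmeasurable_weight : mxmeasurable W.
Proof.
have cover : [set: Rn R n] = \bigcup_k cube_set (centered_cube (2 * k%:R)).
  apply/seteqP; split => x // _; exists (Num.truncn (enorm x)).+1 => //.
  apply: enorm_le_cube; apply: ltW.
  by have /andP[] := truncn_itv (enorm_ge0 x).
have mC k : measurable (cube_set (centered_cube (2 * k%:R)) : set (Rn R n)).
  exact: measurable_cube.
move=> i j; split; rewrite cover; apply/(measurable_fun_bigcup _ mC) => k.
- have [/integrableP[h _] _] := WW.2 i j _ (mC k) (bounded_cube _).
  exact/measurable_EFinP.
- have [_ /integrableP[h _]] := WW.2 i j _ (mC k) (bounded_cube _).
  exact/measurable_EFinP.
Qed.

Definition weight_norm (A : 'M[R[i]]_m) (x : Rn R n) : R := opnorm (W x *m A).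

Lemma weight_norm_ge0 A x : 0 <= weight_norm A x.
Proof. exact: opnorm_ge0. Qed.

Lemma measurable_weight_norm A : measurable_fun setT (weight_norm A).
Proof.
apply: (measurable_opnorm m_gt0); apply: mxmeasurableM.
  exact: mxmeasurable_weight.
exact: mxmeasurable_cst.
Qed.

Lemma measurable_weight_norm2 : measurable_fun [set: Rn R n * Rn R n]
  (fun z => weight_norm (invmx (W z.2)) z.1).
Proof.
apply: (measurable_opnorm m_gt0); apply: mxmeasurableM => i j.
- have [h1 h2] := mxmeasurable_weight i j.
  by split; [exact: (measurableT_comp h1 measurable_fst)
            |exact: (measurableT_comp h2 measurable_fst)].
- have [h1 h2] := mxmeasurable_inv mxmeasurable_weight i j.
  by split; [exact: (measurableT_comp h1 measurable_snd)
            |exact: (measurableT_comp h2 measurable_snd)].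
Qed.

Lemma measurable_pow_integral_weight A (s : R) : measurable A ->
  measurable_fun setT (fun y => pow_integral q (weight_norm (invmx (W y))) A s).
Proof.
move=> mA.
pose f (z : Rn R n * Rn R n) : \bar R :=
  (((weight_norm (invmx (W z.2)) z.1 / s) `^ q z.1) * \1_A z.1)%:E.
have mf : measurable_fun setT f.
  apply/measurable_EFinP; apply: measurable_funM.
    apply: measurable_fun_powR2.
      apply: measurable_funM; first exact: measurable_weight_norm2.
      exact: measurable_cst.
    exact: (measurableT_comp mq measurable_fst).
  have mI : measurable_fun setT (\1_A : Rn R n -> R) by exact: measurable_indic.
  exact: (measurableT_comp mI measurable_fst).
have f0 z : (0 <= f z)%E by rewrite lee_fin mulr_ge0// powR_ge0.
have := measurable_fun_fubini_tonelli_G (m1 := mu) f mf f0.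
rewrite /fubini_G; congr measurable_fun; apply/funext => y.
rewrite /pow_integral [RHS]integral_mkcond; apply: eq_integral => x _.
by rewrite patchE /f /= indicE; case: ifPn => _; rewrite ?mulr1 ?mulr0.
Qed.

(** By Tonelli the integral is measurable in [y], and a strict sublevel set of
    the norm is a countable union, over rational levels, of sublevel sets of
    such integrals. *)
Lemma measurable_restr_norm_weight A : measurable A ->
  measurable_fun setT (fun y => restr_norm p (weight_norm (invmx (W y))) A).
Proof.
move=> mA; apply: (measurability _ (ErealGenInftyO.measurableE R)).
move=> _ [_ [r ->] <-]; rewrite setTI.
pose S (w : rat) := if (0 < ratr w :> R) && (ratr w < r)
  then [set y | (pow_integral q (weight_norm (invmx (W y))) A (ratr w) <= 1)%E] else set0.
have mS w : measurable (S w).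
  rewrite /S; case: ifP => // _.
  have := measurable_pow_integral_weight (ratr w) mA.
  move=> /emeasurable_fun_infty_c => /(_ measurableT 1%E).
  by rewrite setTI.
rewrite (_ : _ @^-1` _ = \bigcup_i (if unpickle i is Some w then S w else set0)).
  by apply: bigcup_measurable => i _; case: (unpickle i).
apply/seteqP; split => y /=.
  rewrite in_itv /= => hr; move: (hr) => /ereal_inf_lt [_ [l [l0 hl] <-]].
  rewrite lte_fin => lr; have [w] := rat_in_itvoo lr.
  rewrite in_itv /= => /andP[w1 w2]; exists (pickle w); first exact: I.
  rewrite pickleK /S w2 (lt_trans l0 w1).
  have u0 := weight_norm_ge0 (invmx (W y)).
  have mu' := measurable_weight_norm (invmx (W y)).
  apply: (lt_restr_norm pE mq pm_gt0 q_ge mA mu' u0).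
  apply: le_lt_trans (_ : (l%:E < _)%E); last by rewrite lte_fin.
  by apply: ereal_inf_lbound; exists l.
move=> [i _]; case: (unpickle i) => //= w; rewrite /S; case: ifP => // /andP[w0 wr] /= h.
rewrite in_itv /=; apply: (@le_lt_trans _ _ (ratr w)%:E); last by rewrite lte_fin.
by apply: (restr_norm_le pE pm_gt0 q_ge _ w0 h) => x; exact: weight_norm_ge0.
Qed.

End weight_measurability.

(** * Matrix weights *)

Lemma measurable_lne (R : realType) : measurable_fun setT (@lne R).
Proof.
apply: (measurability _ (ErealGenInftyO.measurableE R)).
move=> _ [_ [r ->] <-]; rewrite setTI.
rewrite (_ : _ @^-1` _ = (`]-oo, (expR r)%:E[%classic : set (\bar R))).
  exact: emeasurable_itv.
apply/seteqP; split => x /=; rewrite !in_itv /=.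
  case: x => [x| |] //=; rewrite ?ltNyr//; case: ifPn => [x0 _|].
    by rewrite lte_fin (le_lt_trans x0)// expR_gt0.
  by rewrite -ltNge => x0; rewrite !lte_fin -ltr_expR lnK.
case: x => [x| |] h; rewrite ?ltNyr//.
have [x0|x0] := leP x 0; first by rewrite le0_lneNy ?ltNyr// lee_fin.
by rewrite lne_EFin// lte_fin -ltr_expR lnK.
Qed.

Lemma ae_le_integral d (T : measurableType d) (R : realType)
    (mu : {measure set T -> \bar R}) (A : set T) (f g : T -> \bar R) :
  measurable A -> measurable_fun A f -> measurable_fun A g ->
  {ae mu, forall x, A x -> (f x <= g x)%E} ->
  (\int[mu]_(x in A) f x <= \int[mu]_(x in A) g x)%E.
Proof.
move=> mA mf mg fg; rewrite integralE [leRHS]integralE; apply: leeB.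
- apply: (ae_ge0_le_integral mA) => //.
  + exact: measurable_funepos.
  + exact: measurable_funepos.
  + by apply: filterS fg => x h /h fgx; rewrite !funeposE ge_max !le_max fgx lexx orbT.
- apply: (ae_ge0_le_integral mA) => //.
  + exact: measurable_funeneg.
  + exact: measurable_funeneg.
  + apply: filterS fg => x h /h fgx; rewrite !funenegE ge_max !le_max leeN2 fgx.
    by rewrite lexx orbT.
Qed.

Section mean_comparison.
Context d (T : measurableType d) (R : realType).
Variables (mu : {measure set T -> \bar R}) (A : set T) (v : R).
Hypothesis mA : measurable A.
Hypothesis muA : mu A = v%:E.

(** Write [a - b] as [(a - f) + (f - b)]. *)
Lemma mean_difference_le (f : T -> R) (a b k B : R) : 0 < v ->
  measurable_fun A f ->
  (\int[mu]_(x in A) (a - f x)%:E <= (k * v)%:E)%E ->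
  (\int[mu]_(x in A) `|f x - b|%:E <= (B * v)%:E)%E ->
  a - b <= k + B.
Proof.
move=> v0 mf h1 h2.
have mfb : measurable_fun A (fun x => f x - b).
  by apply: measurable_funB => //; exact: measurable_cst.
have if_ : mu.-integrable A (EFin \o (fun x => f x - b)).
  apply/integrableP; split; first exact/measurable_EFinP.
  exact: le_lt_trans h2 (ltry _).
have ic c : mu.-integrable A (EFin \o (fun=> c : R)).
  apply/integrableP; split; first exact/measurable_EFinP/measurable_cst.
  by rewrite integral_cst// [X in (_ * X)%E]muA -EFinM ltry.
have ia : mu.-integrable A (EFin \o (fun x => a - f x)).
  have -> : EFin \o (fun x => a - f x) =
      ((EFin \o (fun=> (a - b)%R)) \- (EFin \o (fun x => (f x - b)%R)))%E.
    by apply/funext => x /=; rewrite -EFinB; congr EFin; ring.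
  exact: integrableB.
rewrite -(ler_pM2r v0) -lee_fin.
have <- : (\int[mu]_(x in A) (a - b)%:E = ((a - b) * v)%:E)%E.
  by rewrite integral_cst// [X in (_ * X)%E]muA -EFinM.
have -> : (\int[mu]_(x in A) (a - b)%:E =
    \int[mu]_(x in A) (EFin \o (fun x => (a - f x)%R)) x +
    \int[mu]_(x in A) (EFin \o (fun x => (f x - b)%R)) x)%E.
  rewrite -integralD//; apply: eq_integral => x _ /=.
  by rewrite -EFinD; congr EFin; ring.
rewrite mulrDl EFinD; apply: leeD => //; apply: le_trans h2.
apply: (ae_le_integral mA).
- exact/measurable_EFinP.
- by apply/measurable_EFinP; apply: measurableT_comp; [exact: normr_measurable|].
- by apply: aeW => x _ /=; rewrite lee_fin ler_norm.
Qed.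

(** The lower bound [g] makes the negative part of [h] integrable, so that an
    upper bound on its integral makes [h] integrable and the constant [k] can
    be taken out. *)
Lemma mean_transfer (h h1 : T -> \bar R) (g : T -> R) (c k r : R) :
  measurable_fun A h -> measurable_fun A h1 -> measurable_fun A g ->
  (\int[mu]_(x in A) `|g x|%:E <= c%:E)%E ->
  {ae mu, forall x, A x -> ((g x)%:E <= h x)%E} ->
  {ae mu, forall x, A x -> (h1 x <= h x + k%:E)%E} ->
  (\int[mu]_(x in A) h x <= r%:E)%E ->
  (\int[mu]_(x in A) h1 x <= (r + k * v)%:E)%E.
Proof.
move=> mh mh1 mg gc gh h1h hr.
have hn : (\int[mu]_(x in A) h^\- x <= c%:E)%E.
  apply: le_trans gc; apply: (ae_ge0_le_integral mA) => //.
  - exact: measurable_funeneg.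
  - by apply/measurable_EFinP; apply: measurableT_comp; [exact: normr_measurable|].
  - apply: filterS gh => x hx Ax; rewrite funenegE ge_max lee_fin normr_ge0 andbT.
    rewrite leeNl; apply: le_trans (hx Ax).
    by rewrite -EFinN lee_fin lerNl -normrN ler_norm.
have hn0 : (0 <= \int[mu]_(x in A) h^\- x)%E by exact: integral_ge0.
have hp : (\int[mu]_(x in A) h^\+ x < +oo)%E.
  move: hr; rewrite integralE leeBlDr; last first.
    by rewrite ge0_fin_numE// (le_lt_trans hn (ltry _)).
  by move=> /le_lt_trans; apply; rewrite lte_add_pinfty ?ltry// (le_lt_trans hn (ltry _)).
have ih : mu.-integrable A h.
  apply/integrableP; split=> //.
  rewrite (eq_integral (fun x => (h^\+ x + h^\- x)%E)); last first.
    by move=> x _; rewrite -[LHS]/((abse \o h) x) fune_abse.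
  rewrite ge0_integralD//.
  - by rewrite lte_add_pinfty// (le_lt_trans hn (ltry _)).
  - exact: measurable_funepos.
  - exact: measurable_funeneg.
have ik : mu.-integrable A (fun=> k%:E).
  apply/integrableP; split; first exact: measurable_cst.
  by rewrite integral_cst// [X in (_ * X)%E]muA -EFinM ltry.
apply: (@le_trans _ _ (\int[mu]_(x in A) (h x + k%:E))%E).
  apply: (ae_le_integral mA) => //.
  by apply: emeasurable_funD => //; exact: measurable_cst.
rewrite (integralD mA ih ik) integral_cst// EFinD leeD//.
by rewrite [X in (_ * X <= _)%E]muA -EFinM.
Qed.

End mean_comparison.

Lemma expR_le_mul (R : realType) (x y : \bar R) (a b o : R) : 0 < o ->
  x = (expR a)%:E -> y = (expR b)%:E -> (x <= o%:E * y)%E -> a <= ln o + b.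
Proof.
by move=> o0 -> ->; rewrite -EFinM lee_fin -{1}(lnK o0) -expRD ler_expR.
Qed.

Lemma eqy_of_le_mul (R : realType) (x y : \bar R) (o : R) :
  (0 <= y)%E -> x = +oo%E -> (x <= o%:E * y)%E -> y = +oo%E.
Proof. by move=> y0 ->; rewrite leye_eq; case: y y0 => //= r _; rewrite -EFinM. Qed.

Lemma lee_EFinD (R : realType) (x y : \bar R) (a b k : R) :
  x = a%:E -> y = b%:E -> a <= b + k -> (x <= y + k%:E)%E.
Proof. by move=> -> ->; rewrite -EFinD lee_fin. Qed.

Lemma ln_dilation_large (R : realType) (d K : R) : d < 0 ->
  exists2 M : nat, (0 < M)%N & K + d * ln (2 * M%:R) < 0.
Proof.
move=> d0; pose X := Num.max 0 (K / - d) + 1.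
exists (Num.truncn (expR X)).+1 => //.
have /andP[_] := truncn_itv (expR_ge0 X); set M := _.+1 => hM.
have M0 : 0 < M%:R :> R by rewrite ltr0n.
have : X < ln (2 * M%:R).
  rewrite -ltr_expR lnK ?posrE ?mulr_gt0//; lra.
have : K / - d <= X - 1 by rewrite /X addrK le_max lexx orbT.
rewrite ler_pdivrMr ?oppr_gt0// => h1 h2.
have h3 : d * ln (2 * M%:R) < d * X by rewrite ltr_nM2l.
by move: h1 h3; rewrite mulrN mulrBl; lra.
Qed.

Section matrix_weights.
Local Open Scope complex_scope.
Context {R : realType} {m n : nat}.
Local Notation mu := (@lebesgueRn R n).
Variables (p : Rn R n -> \bar R) (q : Rn R n -> R) (pm pM rinf C : R).
Hypothesis m_gt0 : (0 < m)%N.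
Hypothesis n_gt0 : (0 < n)%N.
Hypothesis pE : forall x, p x = (q x)%:E.
Hypothesis mq : measurable_fun setT q.
Hypothesis pm_gt0 : 0 < pm.
Hypothesis q_ge : forall x, pm <= q x.
Hypothesis q_le : forall x, q x <= pM.
Implicit Types (Q D : cube R n).
Hypothesis C_gt0 : 0 < C.
Hypothesis hC : forall Q, 0 < cube_edge Q ->
  [/\ restr_norm p (fun=> 1%R) (cube_set Q) = (expR (log_norm1 p Q))%:E,
     `|log_norm1 p Q - ln (vol Q) / ref_exponent q rinf Q| <= C &
     (\int[mu]_(x in cube_set Q) (log_osc q rinf Q x)%:E <= (C * vol Q)%:E)%E].
Hypothesis hD : forall Q l, 0 < cube_edge Q -> 1 <= l ->
  log_norm1 p (dilate l Q) - log_norm1 p Q <= C + n%:R / pm * ln l.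

Variable W : Rn R n -> 'M[R[i]]_m.
Hypothesis WW : matrix_weight W.

Local Notation u_ := (weight_norm W).
Local Notation N_ Q := (normalized_norm p W (cube_set Q)).

Let W_unit : {ae mu, forall y, W y \in unitmx}.
Proof. by apply: filterS WW.1 => y []. Qed.

Lemma weight_norm_gt0 A : A \in unitmx -> {ae mu, forall x, 0 < u_ A x}.
Proof.
move=> uA; apply: filterS W_unit => x ux.
by apply: opnorm_gt0 => //; rewrite unitmx_mul ux.
Qed.

Lemma normalized_normE Q y : 0 < cube_edge Q ->
  N_ Q y = ((expR (- log_norm1 p Q))%:E * restr_norm p (u_ (invmx (W y))) (cube_set Q))%E.
Proof.
move=> Q0; rewrite /normalized_norm vnorm_indic; have [-> _ _] := hC Q0.
by rewrite inver gt_eqF ?expR_gt0// expRN.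
Qed.

Lemma measurable_lne_normalized_norm Q (D : set (Rn R n)) : 0 < cube_edge Q ->
  measurable_fun D (fun y => lne (N_ Q y)).
Proof.
move=> Q0; apply: measurable_funTS; apply: (measurableT_comp (@measurable_lne R)).
have -> : N_ Q = (fun y => ((expR (- log_norm1 p Q))%:E *
    restr_norm p (u_ (invmx (W y))) (cube_set Q))%E).
  by apply/funext => y; exact: normalized_normE.
apply: measurable_funeM.
exact: (measurable_restr_norm_weight pE mq pm_gt0 q_ge m_gt0 WW (measurable_cube Q)).
Qed.

Lemma exp_mean_log_le (k : R) D Q : 0 < cube_edge D ->
  (exp_mean_log p W (cube_set D) (cube_set Q) <= (expR k)%:E)%E <->
  (\int[mu]_(y in cube_set D) lne (N_ Q y) <= (k * vol D)%:E)%E.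
Proof.
move=> D0; have v0 := vol_gt0 D0.
rewrite /exp_mean_log /average.
rewrite [X in (expeR (X^-1 * _))%E](lebesgue_cube D0) inver gt_eqF//.
by rewrite -[X in (_ <= X)%E]/(expeR k%:E) lee_expeR lee_pdivrMl// -EFinM mulrC.
Qed.

Lemma mean_le_of_exp_mean_le (c : R) : 0 < c ->
  (forall Q, 0 < cube_edge Q ->
    (exp_mean_log p W (cube_set Q) (cube_set Q) <= c%:E)%E) ->
  forall Q, 0 < cube_edge Q ->
    (\int[mu]_(y in cube_set Q) lne (N_ Q y) <= (Num.max 0 (ln c) * vol Q)%:E)%E.
Proof.
move=> c0 h Q Q0; apply/(exp_mean_log_le _ _ Q0); apply: le_trans (h Q Q0) _.
by rewrite lee_fin -{1}(lnK c0) ler_expR le_max lexx orbT.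
Qed.

(** [W x *m A] is [W x *m invmx (W y)] times [W y *m A]. *)
Lemma restr_norm_weight_le A y Q : W y \in unitmx -> A \in unitmx ->
  (restr_norm p (u_ A) (cube_set Q) <=
    (u_ A y)%:E * restr_norm p (u_ (invmx (W y))) (cube_set Q))%E.
Proof.
move=> uW uA.
have mQ := measurable_cube Q.
have o0 : 0 < u_ A y by apply: opnorm_gt0 => //; rewrite unitmx_mul uW.
have mu1 := measurable_weight_norm m_gt0 WW A.
have mu2 := measurable_weight_norm m_gt0 WW (invmx (W y)).
have g1 := weight_norm_ge0 W m_gt0 A.
have g2 := weight_norm_ge0 W m_gt0 (invmx (W y)).
apply: (restr_norm_mono pE mq pm_gt0 q_ge mQ mQ (@subset_refl _ _) mu2 mu1 g1 g2 o0).
move=> x _; rewrite mulrC /weight_norm.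
have -> : W x *m A = (W x *m invmx (W y)) *m (W y *m A).
  by rewrite mulmxA -(mulmxA (W x)) mulVmx// mulmx1.
exact: opnormM.
Qed.

Variable kappa : R.
Hypothesis kappa_ge0 : 0 <= kappa.
Hypothesis hkappa : forall Q, 0 < cube_edge Q ->
  (\int[mu]_(y in cube_set Q) lne (N_ Q y) <= (kappa * vol Q)%:E)%E.

(** If the norm of [u_ A] were infinite, so would be the averaged quantity at
    almost every [y]. *)
Lemma restr_norm_weight_lty A Q : A \in unitmx -> 0 < cube_edge Q ->
  (restr_norm p (u_ A) (cube_set Q) < +oo)%E.
Proof.
move=> uA Q0; rewrite ltey; apply/eqP => Foo.
have mQ := measurable_cube Q.
have : (+oo <= (kappa * vol Q)%:E)%E; last by rewrite leye_eq.
apply: le_trans (hkappa Q0).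
have <- : (\int[mu]_(y in cube_set Q) (cst +oo%E y : \bar R) = +oo)%E.
  rewrite integral_cst// [X in (_ * X)%E](lebesgue_cube Q0) gt0_mulye// lte_fin.
  exact: vol_gt0.
apply: (ae_le_integral mQ).
- exact: measurable_cst.
- exact: measurable_lne_normalized_norm.
apply: filterS W_unit => y uy Qy.
rewrite normalized_normE//.
have -> := eqy_of_le_mul (restr_norm_ge0 p (u_ (invmx (W y))) (cube_set Q)) Foo
  (restr_norm_weight_le Q uy uA).
by rewrite gt0_muley// lte_fin expR_gt0.
Qed.

Lemma restr_norm_weightE A Q : A \in unitmx -> 0 < cube_edge Q ->
  restr_norm p (u_ A) (cube_set Q) = (expR (log_norm p (u_ A) Q))%:E.
Proof.
move=> uA; apply: (restr_normE pE mq pm_gt0 q_ge).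
- exact: measurable_weight_norm.
- exact: weight_norm_ge0.
- exact: weight_norm_gt0.
- by move=> Q'; exact: restr_norm_weight_lty.
Qed.

Lemma lne_normalized_norm y Q : W y \in unitmx -> 0 < cube_edge Q ->
  lne (N_ Q y) = (log_ratio p (u_ (invmx (W y))) Q)%:E.
Proof.
move=> uy Q0; rewrite normalized_normE// restr_norm_weightE ?unitmx_inv//.
by rewrite -EFinM -expRD lne_EFin ?expR_gt0// expRK addrC.
Qed.

(** The scalar condition satisfied by every [u_ A]. *)
Lemma log_ratio_sub_le A y Q : A \in unitmx -> W y \in unitmx -> 0 < cube_edge Q ->
  ((log_ratio p (u_ A) Q - ln (u_ A y))%:E <= lne (N_ Q y))%E.
Proof.
move=> uA uy Q0; rewrite lne_normalized_norm// lee_fin.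
have o0 : 0 < u_ A y by apply: opnorm_gt0 => //; rewrite unitmx_mul uy.
have uV : invmx (W y) \in unitmx by rewrite unitmx_inv.
have := expR_le_mul o0 (restr_norm_weightE uA Q0) (restr_norm_weightE uV Q0)
  (restr_norm_weight_le Q uy uA).
by rewrite /log_ratio addrAC lerD2r lerBlDl.
Qed.

Lemma measurable_ln_weight A : measurable_fun setT (fun x => ln (u_ A x)).
Proof.
exact: (measurableT_comp (@measurable_ln R) (measurable_weight_norm m_gt0 WW A)).
Qed.

Lemma integral_log_ratio_sub_le A D Q : A \in unitmx -> 0 < cube_edge Q ->
  (\int[mu]_(y in cube_set D) (log_ratio p (u_ A) Q - ln (u_ A y))%:E
   <= \int[mu]_(y in cube_set D) lne (N_ Q y))%E.
Proof.
move=> uA Q0; have mD := measurable_cube D.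
apply: (ae_le_integral mD).
- apply/measurable_EFinP/measurable_funTS.
  by apply: measurable_funB; [exact: measurable_cst|exact: measurable_ln_weight].
- exact: measurable_lne_normalized_norm.
- by apply: filterS W_unit => y uy _; exact: log_ratio_sub_le.
Qed.

Let weight_kappa A (uA : A \in unitmx) Q (Q0 : 0 < cube_edge Q) :
  (\int[mu]_(y in cube_set Q) (log_norm p (u_ A) Q - log_norm1 p Q - ln (u_ A y))%:E
   <= (kappa * vol Q)%:E)%E.
Proof. exact: le_trans (integral_log_ratio_sub_le Q uA Q0) (hkappa Q0). Qed.

Local Notation B := (osc_bound pm C kappa).

Lemma weight_mean_osc_le A Q : A \in unitmx -> 0 < cube_edge Q ->
  (\int[mu]_(x in cube_set Q) `|ln (u_ A x) - log_ratio p (u_ A) Q|%:E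
   <= (B * vol Q)%:E)%E.
Proof.
move=> uA Q0.
exact: (mean_osc_le pE mq pm_gt0 q_ge C_gt0 hC (measurable_weight_norm m_gt0 WW A)
  (weight_norm_ge0 W m_gt0 A) (weight_norm_gt0 uA)
  (fun Q => @restr_norm_weight_lty A Q uA) (weight_kappa uA) Q0).
Qed.

(** Turns an upper bound on a mean over [D] of the norm over [Q] into a
    comparison of centre values; both dimension conditions are of this
    shape, with the roles of the cube and its dilate exchanged. *)
Lemma log_ratio_sub_of_mean_le D Q k : 0 < cube_edge D -> 0 < cube_edge Q ->
  (\int[mu]_(y in cube_set D) lne (N_ Q y) <= (k * vol D)%:E)%E ->
  log_ratio p (u_ 1%:M) Q - log_ratio p (u_ 1%:M) D <= k + B.
Proof.
move=> D0 Q0 h.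
apply: (mean_difference_le (measurable_cube D) (lebesgue_cube D0) (vol_gt0 D0)
  _ _ (weight_mean_osc_le (unitmx1 _ _) D0)).
  exact/measurable_funTS/measurable_ln_weight.
exact: le_trans (integral_log_ratio_sub_le D (unitmx1 _ _) Q0) h.
Qed.

(** At almost every [y] the averaged quantities are the centre values of the
    weight [u_ (invmx (W y))], so an estimate uniform in [A] may be
    averaged. *)
Lemma mean_normalized_norm_transfer Q1 Q2 k : 0 < cube_edge Q1 -> 0 < cube_edge Q2 ->
  (forall A, A \in unitmx -> log_ratio p (u_ A) Q1 <= log_ratio p (u_ A) Q2 + k) ->
  (\int[mu]_(y in cube_set Q2) lne (N_ Q1 y) <= ((kappa + k) * vol Q2)%:E)%E.
Proof.
move=> Q10 Q20 hk.
pose g y := log_ratio p (u_ 1%:M) Q2 - ln (u_ 1%:M y).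
have gB : (\int[mu]_(x in cube_set Q2) `|g x|%:E <= (B * vol Q2)%:E)%E.
  apply: le_trans (weight_mean_osc_le (unitmx1 _ _) Q20).
  by under eq_integral do rewrite /g distrC.
rewrite mulrDl.
apply: (mean_transfer (measurable_cube Q2) (lebesgue_cube Q20) _ _ _ gB _ _ (hkappa Q20)).
- exact: measurable_lne_normalized_norm.
- exact: measurable_lne_normalized_norm.
- apply: measurable_funTS.
  by apply: measurable_funB; [exact: measurable_cst|exact: measurable_ln_weight].
- by apply: filterS W_unit => y uy _; exact: log_ratio_sub_le (unitmx1 _ _) uy Q20.
- apply: filterS W_unit => y uy _.
  have uV : invmx (W y) \in unitmx by rewrite unitmx_inv.
  exact: lee_EFinD (lne_normalized_norm uy Q10) (lne_normalized_norm uy Q20) (hk _ uV).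
Qed.

Local Notation gain := (@step_gain R n pm pM C kappa).

Lemma mean_lower_dilate_le Q l : 0 < cube_edge Q -> 1 <= l ->
  (\int[mu]_(y in cube_set (dilate l Q)) lne (N_ Q y)
   <= ((kappa + ((C + gain) + (n%:R / pm - gain / ln 3) * ln l)) * vol (dilate l Q))%:E)%E.
Proof.
move=> Q0 l1; apply: mean_normalized_norm_transfer => //.
  by rewrite /= mulr_gt0// (lt_le_trans ltr01).
move=> A uA; rewrite addrA.
exact: (log_ratio_le_dilate n_gt0 pE mq pm_gt0 q_ge q_le C_gt0 hC hD
  (measurable_weight_norm m_gt0 WW A)
  (weight_norm_ge0 W m_gt0 A) (weight_norm_gt0 uA) kappa_ge0
  (fun Q => @restr_norm_weight_lty A Q uA) (weight_kappa uA) Q0 l1).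
Qed.

Lemma mean_upper_dilate_le Q l : 0 < cube_edge Q -> 1 <= l ->
  (\int[mu]_(y in cube_set Q) lne (N_ (dilate l Q) y)
   <= ((kappa + (B * (2 ^+ n + 1) + B * (2 ^+ n + 1) / ln 2 * ln l)) * vol Q)%:E)%E.
Proof.
move=> Q0 l1; apply: mean_normalized_norm_transfer => //.
  by rewrite /= mulr_gt0// (lt_le_trans ltr01).
move=> A uA; rewrite addrA.
exact: (log_ratio_dilate_le pE mq pm_gt0 q_ge C_gt0 hC
  (measurable_weight_norm m_gt0 WW A)
  (weight_norm_ge0 W m_gt0 A) (weight_norm_gt0 uA) kappa_ge0
  (fun Q => @restr_norm_weight_lty A Q uA) (weight_kappa uA) Q0 l1).
Qed.

Lemma exists_weight_stable_dilate (M : nat) : (0 < M)%N ->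
  exists Q, 0 < cube_edge Q /\
    `|log_ratio p (u_ 1%:M) (dilate (2 * M%:R) Q) - log_ratio p (u_ 1%:M) Q|
    <= B * (2 ^+ n + 4).
Proof.
apply: (exists_cube_stable_dilate (measurable_ln_weight 1%:M)).
  exact: osc_bound_gt0 pm_gt0 C_gt0 _ kappa_ge0.
by move=> Q; exact: weight_mean_osc_le (unitmx1 _ _).
Qed.

(** With [d < 0] the left-hand side grows like [|d| ln l], against
    [exists_weight_stable_dilate]. *)
Lemma log_ratio_decay_false (k d : R) : d < 0 ->
  ~ (forall l Q, 1 <= l -> 0 < cube_edge Q -> - (k + d * ln l)
      <= `|log_ratio p (u_ 1%:M) (dilate l Q) - log_ratio p (u_ 1%:M) Q|).
Proof.
move=> d0 h; have [M M0 hM] := ln_dilation_large (k + B * (2 ^+ n + 4)) d0.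
have [Q [Q0 hQ]] := exists_weight_stable_dilate M0.
have l1 : 1 <= 2 * M%:R :> R.
  have : 1 <= M%:R :> R by rewrite ler1n.
  lra.
have := le_trans (h _ Q l1 Q0) hQ.
rewrite lerNl -subr_ge0 opprK => hN.
by move: hM; rewrite addrAC ltNge hN.
Qed.

End matrix_weights.

(** * The exponent, and the three statements *)

(** A cube is not negligible. *)
Lemma ae_exists_in_cube (R : realType) (n : nat) (P : Rn R n -> Prop) (Q : cube R n) :
  0 < cube_edge Q -> {ae @lebesgueRn R n, forall x, P x} -> exists2 x, cube_set Q x & P x.
Proof.
move=> Q0 [N [mN N0 PN]]; apply: contrapT => h.
have : (lebesgueRn (cube_set Q) <= lebesgueRn N)%E.
  apply: le_measure; rewrite ?inE//; first exact: measurable_cube.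
  by move=> x Qx; apply: PN => /= Px; apply: h; exists x.
rewrite [X in (_ <= X)%E]N0 [X in (X <= _)%E](lebesgue_cube Q0) lee_fin leNgt.
by rewrite vol_gt0.
Qed.

Section exponent.
Context {R : realType} {n : nat}.
Variable p : Rn R n -> \bar R.
Hypothesis n_gt0 : (0 < n)%N.
Hypothesis pP0 : P0 p.
Hypothesis p_fin : forall x, p x \is a fin_num.

Let q x := fine (p x).

Lemma p_fineE x : p x = (q x)%:E.
Proof. by rewrite /q fineK. Qed.

Lemma p_minus_fin_num : p_minus p = (fine (p_minus p))%:E.
Proof.
have [_ _ pm0] := pP0.
have [x _ hx] := @ae_exists_in_cube R n _ (centered_cube 1) ltr01
  (ess_inf_le (@lebesgueRn R n) p).
rewrite fineK// gt0_fin_numE//; apply: le_lt_trans hx _.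
by rewrite ltey_eq p_fin.
Qed.

Lemma p_minus_gt0 : 0 < fine (p_minus p).
Proof. by have [_ _] := pP0; rewrite p_minus_fin_num lte_fin. Qed.

(** By continuity of the exponent, the almost everywhere bound by the
    essential infimum holds everywhere. *)
Lemma p_minus_le C0 x : 0 < C0 ->
  (forall x y, Defs.edist x y < 2^-1 ->
     `|q x - q y| <= - (C0 / ln (Defs.edist x y))) ->
  fine (p_minus p) <= q x.
Proof.
move=> C00 LH0; rewrite leNgt; apply/negP => qx.
set d := fine (p_minus p) - q x; have d0 : 0 < d by rewrite subr_gt0.
pose X := C0 / d + 2.
have Cd : 0 < C0 / d by rewrite divr_gt0.
have nR : 0 < n%:R :> R by rewrite ltr0n.
pose Q := Cube x (expR (- X) / n%:R) (fun=> true) (fun=> true).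
have Q0 : 0 < cube_edge Q by rewrite divr_gt0// expR_gt0.
have [y Qy] := ae_exists_in_cube Q0 (ess_inf_le (@lebesgueRn R n) p).
rewrite -/(p_minus p) p_minus_fin_num p_fineE lee_fin => py.
have := edist_center_le Qy; rewrite /= mulrC divfK ?gt_eqF// => ed.
have X2 : 2 < X by rewrite /X; lra.
have ed2 : Defs.edist y x < 2^-1.
  apply: le_lt_trans ed _; rewrite expRN ltf_pV2 ?posrE ?expR_gt0//.
  by have := expR_ge1Dx X; lra.
have := LH0 y x ed2.
have e0 : 0 <= Defs.edist y x by exact: sqrtr_ge0.
suff : - (C0 / ln (Defs.edist y x)) < d.
  by move=> h1 /(le_trans (ler_norm _)); rewrite /d in h1; lra.
move: e0; rewrite le_eqVlt => /orP[/eqP <-|e0].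
  by rewrite ln0// invr0 mulr0 oppr0.
have lne : X <= - ln (Defs.edist y x).
  by rewrite lerNr -ler_expR lnK.
rewrite -mulrN -invrN ltr_pdivrMr; last by lra.
apply: lt_le_trans (_ : d * X <= _); last by rewrite ler_pM2l.
by rewrite /X mulrDr mulrCA divff ?gt_eqF// mulr1; lra.
Qed.

Lemma p_minus_le_infty (pm rinf Cinf : R) : 0 < Cinf ->
  (forall x, pm <= q x) ->
  (forall x, `|q x - rinf| <= Cinf / ln (expR 1 + enorm x)) ->
  pm <= rinf.
Proof.
move=> Ci0 q_ge h; rewrite leNgt; apply/negP => lt.
set d := pm - rinf; have d0 : 0 < d by rewrite subr_gt0.
pose X := Cinf / d + 1.
have Cd : 0 < Cinf / d by rewrite divr_gt0.
pose x : Rn R n := point_of (fun=> expR X).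
have xX : expR X <= enorm x.
  have := coord_le_enorm x (Ordinal n_gt0).
  by rewrite coord_point_of ger0_norm ?expR_ge0.
have lX : X <= ln (expR 1 + enorm x).
  rewrite -ler_expR lnK ?posrE ?ltr_wpDr ?enorm_ge0 ?expR_gt0//.
  by have := expR_gt0 (1 : R); lra.
have X0 : 0 < X by rewrite /X; lra.
have : d <= Cinf / X.
  have h1 := le_trans (ler_norm _) (h x).
  apply: (@le_trans _ _ (Cinf / ln (expR 1 + enorm x))).
    by have := q_ge x; rewrite /d; lra.
  by rewrite ler_pM2l// lef_pV2 ?posrE// (lt_le_trans X0).
rewrite ler_pdivlMr// /X mulrDr mulrCA divff ?gt_eqF//; lra.
Qed.

End exponent.

Theorem proposition3p22 (R : realType) (m n : nat) (p : Rn R n -> \bar R)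
    (m_gt0 : (0 < m)%N) (n_gt0 : (0 < n)%N)
    (pP0 : P0 p) (p_fin : forall x, p x \is a fin_num)
    (pLH : LH (fun x => fine (p x))) :
  [/\ forall d : R, d < 0 ->
        D_lower p d = set0 :> set (Rn R n -> 'M[R[i]%C]_m) /\
        D_upper p d = set0 :> set (Rn R n -> 'M[R[i]%C]_m),
      forall W : Rn R n -> 'M[R[i]%C]_m, A_infty p W ->
        exists d1 : R, [/\ 0 <= d1, (d1%:E < n%:R%:E / p_minus p)%E &
          D_lower p d1 W] &
      forall W : Rn R n -> 'M[R[i]%C]_m, A_infty p W ->
        exists d2 : R, 0 <= d2 /\ D_upper p d2 W].
Proof.
have [mq [C0 C0_gt0 LH0] [rinf [Cinf [rinf_gt0 Cinf_gt0 LHinf]]]] := pLH.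
pose q x := fine (p x); pose pm := fine (p_minus p).
have pE x : p x = (q x)%:E by exact: p_fineE.
have pmE : p_minus p = pm%:E by exact: p_minus_fin_num.
have pm_gt0 : 0 < pm by exact: p_minus_gt0.
have q_ge x : pm <= q x by exact: (p_minus_le n_gt0 pP0 p_fin x C0_gt0 LH0).
have rinf_ge : pm <= rinf by exact: (p_minus_le_infty n_gt0 Cinf_gt0 q_ge LHinf).
pose pM := rinf + Cinf.
have rinf_le : rinf <= pM by rewrite lerDl ltW.
have q_le x : q x <= pM.
  rewrite -lerBlDl; apply: le_trans (ler_norm _) _; apply: le_trans (LHinf x) _.
  by rewrite ler_pdivrMr ?(lt_le_trans ltr01 (ln_enorm_ge1 x))// ler_peMr ?ln_enorm_ge1// ltW.
have [C1 C1_gt0 hC1] := log_norm1_bound n_gt0 pE mq pm_gt0 q_ge q_le C0_gt0 LH0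
  rinf_ge rinf_le Cinf_gt0 LHinf.
(* Twice [C1]: in [hD] two cubes are compared with their reference exponents. *)
pose C := 2 * C1.
have C_gt0 : 0 < C by rewrite mulr_gt0.
have hC (Q : cube R n) : 0 < cube_edge Q ->
  [/\ restr_norm p (fun=> 1%R) (cube_set Q) = (expR (log_norm1 p Q))%:E,
     `|log_norm1 p Q - ln (vol Q) / ref_exponent q rinf Q| <= C &
     (\int[lebesgueRn]_(x in cube_set Q) (log_osc q rinf Q x)%:E <= (C * vol Q)%:E)%E].
  move=> Q0; have [h1 h2 h3] := hC1 Q Q0; split=> //.
    by apply: le_trans h2 _; rewrite /C; lra.
  by apply: le_trans h3 _; rewrite lee_fin ler_pM2r ?vol_gt0// /C; lra.
have hD (Q : cube R n) l : 0 < cube_edge Q -> 1 <= l ->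
    log_norm1 p (dilate l Q) - log_norm1 p Q <= C + n%:R / pm * ln l.
  move=> Q0 l1; have lQ0 : 0 < cube_edge (dilate l Q).
    by rewrite /= mulr_gt0// (lt_le_trans ltr01).
  have [_ h1 _] := hC1 _ Q0; have [_ h2 _] := hC1 _ lQ0.
  have h3 := ref_exponent_dilate pm_gt0 q_ge rinf_ge l1 Q0.
  move: h1 h2 h3; rewrite !ler_norml /C.
  move: (log_norm1 p Q) (log_norm1 p (dilate l Q)) (ln (vol Q) / _) (ln (vol (dilate l Q)) / _) => a b s t.
  by move=> /andP[? ?] /andP[? ?] ?; lra.
have expE (a l e : R) : 1 <= l -> expR a * l `^ e = expR (a + e * ln l).
  by move=> l1; rewrite /powR gt_eqF ?expRD// (lt_le_trans ltr01).
have Ainf_kappa (W : Rn R n -> 'M[R[i]%C]_m) : A_infty p W ->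
    exists kappa, 0 <= kappa /\ forall Q : cube R n, 0 < cube_edge Q ->
    (\int[lebesgueRn]_(y in cube_set Q) lne (normalized_norm p W (cube_set Q) y)
      <= (kappa * vol Q)%:E)%E.
  move=> [_ Sfin].
  have [r hr] : exists r, (A_infty_constant p W <= r%:E)%E.
    by move: Sfin; case: (A_infty_constant p W) => [r| |] // _;
      [exists r|exists 0; rewrite leNye].
  have r0 : 0 < Num.max r 1 by rewrite lt_max ltr01 orbT.
  exists (Num.max 0 (ln (Num.max r 1))); split; first by rewrite le_max lexx.
  apply: (mean_le_of_exp_mean_le r0) => Q Q0.
  apply: le_trans (_ : (r%:E <= _)%E); last by rewrite lee_fin le_max lexx.
  by apply: le_trans hr; apply: ereal_sup_ubound; exists Q.
split.
(* The case [l = 1] of either dimension condition makes [W] satisfy the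
   oscillation bound, which the decay for large [l] contradicts. *)
- move=> d d0; split; apply/seteqP; split => W //= -[WW [c c0 h]].
  + have h1 (Q : cube R n) : 0 < cube_edge Q ->
        (exp_mean_log p W (cube_set Q) (cube_set Q) <= c%:E)%E.
      by move=> Q0; have := h 1 Q (lexx _) Q0; rewrite dilate1 powR1 mulr1.
    have k0 : 0 <= Num.max 0 (ln c) by rewrite le_max lexx.
    have hk := mean_le_of_exp_mean_le c0 h1.
    apply: (log_ratio_decay_false m_gt0 pE mq pm_gt0 q_ge C_gt0 hC WW k0 hk
      (k := ln c + osc_bound pm C (Num.max 0 (ln c))) d0) => l Q l1 Q0.
    have lQ0 : 0 < cube_edge (dilate l Q) by rewrite /= mulr_gt0// (lt_le_trans ltr01).
    have := h l Q l1 Q0; rewrite -{1}(lnK c0) expE// => /(exp_mean_log_le p W _ Q lQ0).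
    move=> /(log_ratio_sub_of_mean_le m_gt0 pE mq pm_gt0 q_ge C_gt0 hC WW hk lQ0 Q0) hl.
    by apply: le_trans _ (ler_norm _); rewrite lerNl opprB [leRHS]addrAC.
  + have h1 (Q : cube R n) : 0 < cube_edge Q ->
        (exp_mean_log p W (cube_set Q) (cube_set Q) <= c%:E)%E.
      by move=> Q0; have := h 1 Q (lexx _) Q0; rewrite dilate1 powR1 mulr1.
    have k0 : 0 <= Num.max 0 (ln c) by rewrite le_max lexx.
    have hk := mean_le_of_exp_mean_le c0 h1.
    apply: (log_ratio_decay_false m_gt0 pE mq pm_gt0 q_ge C_gt0 hC WW k0 hk
      (k := ln c + osc_bound pm C (Num.max 0 (ln c))) d0) => l Q l1 Q0.
    have lQ0 : 0 < cube_edge (dilate l Q) by rewrite /= mulr_gt0// (lt_le_trans ltr01).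
    have := h l Q l1 Q0.
    rewrite -{1}(lnK c0) expE// => /(exp_mean_log_le p W _ (dilate l Q) Q0).
    move=> /(log_ratio_sub_of_mean_le m_gt0 pE mq pm_gt0 q_ge C_gt0 hC WW hk Q0 lQ0) hl.
    by rewrite distrC; apply: le_trans _ (ler_norm _); rewrite lerNl opprB [leRHS]addrAC.
- move=> W WA; have WW := WA.1; have [kappa [k0 hk]] := Ainf_kappa W WA.
  pose g := @step_gain R n pm pM C kappa.
  have g0 : 0 < g by exact: step_gain_gt0 pm_gt0 q_ge q_le C_gt0 _ k0.
  have ln3 : 0 < ln 3 :> R by rewrite ln_gt0// ltr1n.
  (* The maximum with 0 is harmless for [l >= 1], and stays below [n / pm]. *)
  pose d1 := Num.max 0 (n%:R / pm - g / ln 3).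
  exists d1; split; first by rewrite le_max lexx.
    have npm : 0 < n%:R / pm by rewrite divr_gt0// ltr0n.
    rewrite pmE inver gt_eqF// -EFinM lte_fin gt_max npm/= ltrBlDr ltrDl.
    exact: divr_gt0.
  split=> //; exists (expR (kappa + (C + g))) => [|l Q l1 Q0]; first exact: expR_gt0.
  have lQ0 : 0 < cube_edge (dilate l Q) by rewrite /= mulr_gt0// (lt_le_trans ltr01).
  rewrite expE//; apply/(exp_mean_log_le p W _ Q lQ0).
  apply: le_trans (mean_lower_dilate_le m_gt0 n_gt0 pE mq pm_gt0 q_ge q_le C_gt0 hC hD
    WW k0 hk Q0 l1) _.
  rewrite lee_fin ler_pM2r ?vol_gt0// addrA lerD2l ler_wpM2r ?ln_ge0//.
  by rewrite le_max lexx orbT.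
- move=> W WA; have WW := WA.1; have [kappa [k0 hk]] := Ainf_kappa W WA.
  pose b := osc_bound pm C kappa * (2 ^+ n + 1).
  have b0 : 0 < b by rewrite mulr_gt0 ?osc_bound_gt0// addr_gt0// exprn_gt0.
  have ln2 : 0 < ln 2 :> R by rewrite ln_gt0// ltr1n.
  exists (b / ln 2); split; first by rewrite divr_ge0// ltW.
  split=> //; exists (expR (kappa + b)) => [|l Q l1 Q0]; first exact: expR_gt0.
  rewrite expE//; apply/(exp_mean_log_le p W _ (dilate l Q) Q0).
  apply: le_trans (mean_upper_dilate_le m_gt0 pE mq pm_gt0 q_ge C_gt0 hC
    WW k0 hk Q0 l1) _.
  by rewrite addrA.
Qed.
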